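(* Consider Algorithm 2 (defined in the context) with positive constant stepsize $\epsilon$. Suppose that for every bus $i$ the difference between consecutive update time steps in $T_i$ is upper bounded by $T_a$, and that for all $i$ and $t$ the delays $\tau_i(t)$ and $\tau_i'(t)$ are upper bounded by $T_d$. If $$\epsilon<\frac{1}{\sigma_{\max}(X)+2\|X\|_F\,(2T_d+T_a)},$$ then $q(t)$ and $\lambda(t)=[\bar{\lambda}(t)^T,\underline{\lambda}(t)^T]^T$ converge, respectively, to the optimizer of the primal problem $$\min_{q}\ \tfrac12 q^TXq\quad\text{s.t.}\quad Xq+v^{par}\le\bar{v},\quad Xq+v^{par}\ge\underline{v},$$ and to the optimizer of the dual problem $$\max_{\bar{\lambda},\underline{\lambda}\ge0}\ D=-\tfrac12(\underline{\lambda}-\bar{\lambda})^TX(\underline{\lambda}-\bar{\lambda})+\bar{\lambda}^T(v^{par}-\bar{v})+\underline{\lambda}^T(\underline{v}-v^{par}),$$ and $v(t)$ converges to a point $v^*\in[\underline{v},\bar{v}]$.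
   Context: Network: a tree with bus set $\{0,1,\dots,n\}$ rooted at bus $0$ (the substation), with edge set $E$; each line $(h,k)\in E$ has reactance $x_{hk}>0$. Let $\mathcal{P}_i\subset E$ be the set of lines on the unique path from bus $0$ to bus $i$. The matrix $X\in\mathbb{R}^{n\times n}$ is $X_{ij}=2\sum_{(h,k)\in\mathcal{P}_i\cap\mathcal{P}_j}x_{hk}$, $1\le i,j\le n$; it is symmetric positive definite. $\sigma_{\max}$ is the largest singular value, $\|\cdot\|_F$ the Frobenius norm. Vector inequalities are componentwise. $\underline{v},\bar{v}\in\mathbb{R}^n$ are the lower and upper voltage limits, and $[\underline{v},\bar{v}]=\{v\in\mathbb{R}^n:\underline{v}_i\le v_i\le\bar{v}_i\ \forall i\}$ is the acceptable range. A fixed arbitrary $v^{par}\in\mathbb{R}^n$ is the operating condition. Voltages $v(t)\in\mathbb{R}^n$ and reactive power injections $q(t)\in\mathbb{R}^n$ satisfy $v(t+1)=Xq(t)+v^{par}$. Let $[a]^+=\max(a,0)$. Algorithm 2: each bus $i\in\{1,\dots,n\}$ has an infinite set $T_i\subseteq\{1,2,\dots\}$ of update time steps, integer delays $\tau_i(t)\ge0$, $\tau_i'(t)\ge0$ (arbitrary nonnegative integers, without effect on the algorithm, when $t\notin T_i$), and two auxiliary variables $\bar{\lambda}_i,\underline{\lambda}_i$. At time $t$: - if $t\notin T_i$: $\bar{\lambda}_i(t)=\bar{\lambda}_i(t-1)$, $\underline{\lambda}_i(t)=\underline{\lambda}_i(t-1)$, $q_i(t)=q_i(t-1)$; - if $t\in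 T_i$: $\bar{\lambda}_i(t)=[\bar{\lambda}_i(t-1)+\epsilon(v_i(t-\tau_i(t))-\bar{v}_i)]^+$, $\underline{\lambda}_i(t)=[\underline{\lambda}_i(t-1)+\epsilon(\underline{v}_i-v_i(t-\tau_i(t)))]^+$, and $q_i(t)=\underline{\lambda}_i(t-\tau_i'(t))-\bar{\lambda}_i(t-\tau_i'(t))$. *)

(* Defs.v *)
From HB Require Import structures.
From mathcomp Require Import all_boot all_order all_algebra.
From mathcomp Require Import all_classical all_reals all_analysis.

Set Implicit Arguments.
Unset Strict Implicit.
Unset Printing Implicit Defensive.

Import Order.TTheory GRing.Theory Num.Theory.
Import numFieldNormedType.Exports.

Local Open Scope ring_scope.

(* The buses are 'I_n.+1, bus 0 (ord0) is the substation, and i : 'I_n stands  *)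
(* for bus i + 1, i.e. lift ord0 i.  A line {h, k} is an unordered pair of     *)
(* buses, encoded as the set [set h; k].                                       *)
Definition line (n : nat) : finType := {set 'I_n.+1}.

Definition adjacent (n : nat) (E : {set line n}) : rel 'I_n.+1 :=
  fun h k => [set h; k]%SET \in E.

Definition is_tree (n : nat) (E : {set line n}) : Prop :=
  [/\ forall l : line n, l \in E -> #|l| = 2%N,
      forall h k : 'I_n.+1, connect (adjacent E) h k
    & (* a simple closed walk on at most two buses is not a graph cycle *)
      forall c : seq 'I_n.+1, ucycle (adjacent E) c -> (size c <= 2)%N].

Definition is_root_path (n : nat) (E : {set line n}) (j : 'I_n.+1)
    (p : seq 'I_n.+1) : Prop :=
  [/\ path (adjacent E) ord0 p, uniq (ord0 :: p) & last ord0 p = j].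

Definition root_lines (n : nat) (E : {set line n}) (j : 'I_n.+1)
    : {set line n} :=
  [set l : line n |
    `[< exists2 p : seq 'I_n.+1, is_root_path E j p &
          l \in pairmap (fun h k => [set h; k]%SET : line n) ord0 p >]]%SET.

Section Definitions.
Variables (R : realType) (n : nat).
Implicit Types (X : 'M[R]_n) (vpar vlo vup : 'cV[R]_n).

Definition reactance_matrix (E : {set line n}) (x : line n -> R) : 'M[R]_n :=
  \matrix_(i, j)
    (2 * \sum_(l in root_lines E (lift ord0 i) :&: root_lines E (lift ord0 j))
           x l).

Definition singular_value X (s : R) : Prop :=
  0 <= s /\ eigenvalue (X^T *m X) (s ^+ 2).

(* A matrix with n > 0 has finitely many, and at least one, singular values,   *)
(* so this supremum is a maximum.                                              *)
Definition sigma_max X : R := sup [set s | singular_value X s]%classic.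

Definition frobenius_norm X : R := Num.sqrt (\sum_i \sum_j X i j ^+ 2).

Definition le_vec (u w : 'cV[R]_n) : Prop := forall i, u i 0 <= w i 0.

Definition primal_objective X (q : 'cV[R]_n) : R :=
  2^-1 * (q^T *m X *m q) 0 0.

Definition primal_feasible X vpar vlo vup (q : 'cV[R]_n) : Prop :=
  le_vec (X *m q + vpar) vup /\ le_vec vlo (X *m q + vpar).

Definition primal_optimizer X vpar vlo vup (q : 'cV[R]_n) : Prop :=
  primal_feasible X vpar vlo vup q /\
  forall q', primal_feasible X vpar vlo vup q' ->
    primal_objective X q <= primal_objective X q'.

Definition dual_objective X vpar vlo vup (lup llo : 'cV[R]_n) : R :=
  - (2^-1 * ((llo - lup)^T *m X *m (llo - lup)) 0 0)
  + (lup^T *m (vpar - vup)) 0 0 + (llo^T *m (vlo - vpar)) 0 0.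

Definition dual_feasible (lup llo : 'cV[R]_n) : Prop :=
  le_vec 0 lup /\ le_vec 0 llo.

Definition dual_optimizer X vpar vlo vup (lup llo : 'cV[R]_n) : Prop :=
  dual_feasible lup llo /\
  forall lup' llo', dual_feasible lup' llo' ->
    dual_objective X vpar vlo vup lup' llo'
      <= dual_objective X vpar vlo vup lup llo.

Definition gaps_bounded (T : set nat) (Ta : nat) : Prop :=
  forall t1 t2 : nat, T t1 -> T t2 -> (t1 < t2)%N ->
    (forall t, (t1 < t < t2)%N -> ~ T t) -> (t2 - t1 <= Ta)%N.

(* Signals are indexed by int: a delay may reach back before time 0, and the   *)
(* values at times t < 0 (as well as the initial values lup 0, llo 0, q 0 and  *)
(* v 0) are unconstrained.                                                     *)
Record algorithm2 X vpar vlo vup (eps : R) (T : 'I_n -> set nat)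
    (tau tau' : 'I_n -> nat -> nat) (lup llo q v : int -> 'cV[R]_n) : Prop :=
  Algorithm2 {
    voltage : forall t : nat, v (t%:Z + 1) = X *m q t%:Z + vpar;
    idle : forall (i : 'I_n) (t : nat), (0 < t)%N -> ~ T i t ->
      [/\ lup t%:Z i 0 = lup (t%:Z - 1) i 0,
          llo t%:Z i 0 = llo (t%:Z - 1) i 0
        & q t%:Z i 0 = q (t%:Z - 1) i 0];
    update : forall (i : 'I_n) (t : nat), (0 < t)%N -> T i t ->
      [/\ lup t%:Z i 0 = Num.max 0
            (lup (t%:Z - 1) i 0
             + eps * (v (t%:Z - (tau i t)%:Z) i 0 - vup i 0)),
          llo t%:Z i 0 = Num.max 0
            (llo (t%:Z - 1) i 0
             + eps * (vlo i 0 - v (t%:Z - (tau i t)%:Z) i 0))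
        & q t%:Z i 0 = llo (t%:Z - (tau' i t)%:Z) i 0
                       - lup (t%:Z - (tau' i t)%:Z) i 0]
  }.

End Definitions.

(* Main.v *)
(* Up to sign the dual objective is a convex quadratic f in the multipliers,   *)
(* and the algorithm is an asynchronous projected gradient descent on f in     *)
(* which the gradient is computed from multipliers at most B = 2 Td + Ta steps *)
(* old.  Charging the resulting gradient error to the last B increments        *)
(* (Frobenius norm and AM-GM) and the curvature to sigma_max, the sum of f and *)
(* of suitably weighted recent squared increments N decreases by at least      *)
(* c N(t) with c = 1/eps - sigma_max - 2 |X|_F B > 0.  As f is bounded below,  *)
(* N tends to 0 and X (llo - lup) stays bounded, so the complementarity        *)
(* residuals of the KKT system tend to 0.  Monotonicity of the KKT system then *)
(* makes the voltages Cauchy, so llo - lup converges; the multipliers converge *)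
(* separately because at each bus one of them tends to 0, or vlo = vup and     *)
(* their sum is nondecreasing and bounded.                                     *)
Require Import Defs.
From HB Require Import structures.
From mathcomp Require Import all_boot all_order all_algebra.
From mathcomp Require Import all_classical all_reals all_analysis.
From mathcomp Require Import ring lra zify.
Import Order.TTheory GRing.Theory Num.Theory.
Import numFieldNormedType.Exports.
Local Open Scope ring_scope.
Local Open Scope classical_set_scope.

Set Implicit Arguments.
Unset Strict Implicit.
Unset Printing Implicit Defensive.

(** * Quadratic forms and singular values *)

(** A voltage is read at most [Td] steps late, the injections behind it were set within the
    preceding [Ta] steps, and they were set from multipliers up to [Td] steps older still. This is
    the staleness bound [2 * Td + Ta]; with [eventually_stale_q] it lets [multipliers_cvg] reduce
    Algorithm 2 to the abstract iteration of [async_ascent_cvg].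

    For that iteration the decisive inequality is [lyapunov_descent], and the stepsize condition
    says exactly that its constant [c] is positive. Vanishing increments ([N_cvg0]) and bounded
    voltages ([m_bounded]) follow. Where the two limits of a bus coincide the energy sees only the
    difference of the multipliers, so their own boundedness needs [ab_bounded]. As every bus acts
    regularly, small steps mean small KKT residuals ([residual_small]), and monotonicity turns these
    into convergence of the voltages ([V_cvg]). The limit is a KKT point, hence optimal by
    [kkt_primal_optimizer] and [kkt_dual_optimizer]. Positive definiteness of [X] comes from the
    tree through [reactance_quadE] and [reactance_quad_eq0]. *)

Lemma sqr_le_mul_of_quadratic_ge0 (R : realFieldType) (a b c : R) :
  (forall t, 0 <= a + 2 * b * t + c * t ^+ 2) -> b ^+ 2 <= a * c.
Proof.
move=> h; have [c0|c0|c0] := ltgtP c 0.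
- have a0 : 0 <= a by have := h 0; rewrite expr0n /= !mulr0 !addr0.
  have nc : 0 < - c by lra.
  (* Here [t >= 1] and [c * t ^+ 2 < - a], so the values at [t] and [- t] have a negative sum: a
     contradiction. *)
  pose t := (a + 1 + `|b|) / - c + 1.
  have t1 : 1 <= t by rewrite lerDr divr_ge0 ?addr_ge0 //; lra.
  have ht : (- c) * t = a + 1 + `|b| - c.
    by rewrite /t mulrDr mulrCA mulfV ?gt_eqF// !mulr1.
  have hb := ler_norm b; have hb0 := normr_ge0 b.
  have h1 := h t; have h2 := h (- t).
  have : c * t ^+ 2 = - (a + 1 + `|b| - c) * t.
    rewrite -ht; ring.
  nra.
- have := h (- b / c); have cN0 : c != 0 by rewrite gt_eqF.
  have -> : a + 2 * b * (- b / c) + c * (- b / c) ^+ 2 = (a * c - b ^+ 2) / c.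
    by field.
  by rewrite pmulr_lge0 ?invr_gt0// subr_ge0.
- rewrite c0 mulr0 in h *; have [->|b0] := eqVneq b 0; first by rewrite expr0n.
  have := h (- (a + 1) / (2 * b)).
  have -> : a + 2 * b * (- (a + 1) / (2 * b)) + 0 * (- (a + 1) / (2 * b)) ^+ 2 = -1.
    by field.
  lra.
Qed.

Lemma sum_cauchy_schwarz (R : realFieldType) (I : finType) (f g : I -> R) :
  (\sum_i f i * g i) ^+ 2 <= (\sum_i f i ^+ 2) * (\sum_i g i ^+ 2).
Proof.
apply: sqr_le_mul_of_quadratic_ge0 => t.
have -> : \sum_i f i ^+ 2 + 2 * (\sum_i f i * g i) * t + (\sum_i g i ^+ 2) * t ^+ 2
    = \sum_i (f i + t * g i) ^+ 2.
  rewrite mulr_sumr !mulr_suml -!big_split /=; apply: eq_bigr => i _; ring.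
by apply: sumr_ge0 => i _; exact: sqr_ge0.
Qed.

Section Dot.
Variables (R : realFieldType) (n : nat).
Implicit Types (u v w : 'cV[R]_n) (A : 'M[R]_n).

Definition dot u w : R := \sum_i u i 0 * w i 0.

Lemma subvE u w i : (u - w) i 0 = u i 0 - w i 0.
Proof. by rewrite !mxE. Qed.

Lemma addvE u w i : (u + w) i 0 = u i 0 + w i 0.
Proof. by rewrite mxE. Qed.

Lemma dotC u w : dot u w = dot w u.
Proof. by apply: eq_bigr => i _; rewrite mulrC. Qed.

Lemma dotDl u v w : dot (u + v) w = dot u w + dot v w.
Proof. by rewrite -big_split; apply: eq_bigr => i _; rewrite mxE mulrDl. Qed.

Lemma dotDr u v w : dot u (v + w) = dot u v + dot u w.
Proof. by rewrite dotC dotDl !(dotC u). Qed.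

Lemma dotZl c u w : dot (c *: u) w = c * dot u w.
Proof. by rewrite mulr_sumr; apply: eq_bigr => i _; rewrite mxE mulrA. Qed.

Lemma dotZr c u w : dot u (c *: w) = c * dot u w.
Proof. by rewrite dotC dotZl dotC. Qed.

Lemma dotNl u w : dot (- u) w = - dot u w.
Proof. by rewrite -scaleN1r dotZl mulN1r. Qed.

Lemma dotNr u w : dot u (- w) = - dot u w.
Proof. by rewrite dotC dotNl dotC. Qed.

Lemma dotBl u v w : dot (u - v) w = dot u w - dot v w.
Proof. by rewrite dotDl dotNl. Qed.

Lemma dotBr u v w : dot u (v - w) = dot u v - dot u w.
Proof. by rewrite dotDr dotNr. Qed.

Lemma dot_ge0 u : 0 <= dot u u.
Proof. by apply: sumr_ge0 => i _; rewrite -expr2 sqr_ge0. Qed.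

Lemma dotE u w : (u^T *m w) 0 0 = dot u w.
Proof. by rewrite mxE; apply: eq_bigr => i _; rewrite mxE. Qed.

Lemma dot_mulmx u A w : dot u (A *m w) = dot (A^T *m u) w.
Proof. by rewrite -!dotE trmx_mul trmxK mulmxA. Qed.

Lemma dot_delta i w : dot (delta_mx i 0) w = w i 0.
Proof.
rewrite /dot (bigD1 i)//= big1 ?addr0 => [|k ki]; rewrite !mxE ?eqxx ?mul1r//.
by rewrite (negPf ki) mul0r.
Qed.

Lemma dot_delta_mulmx i A : dot (delta_mx i 0) (A *m delta_mx i 0) = A i i.
Proof. by rewrite dot_delta -colE mxE. Qed.

Lemma psd_cauchy_schwarz A : A^T = A -> (forall w, 0 <= dot w (A *m w)) ->
  forall u w, dot u (A *m w) ^+ 2 <= dot u (A *m u) * dot w (A *m w).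
Proof.
move=> As Ap u w; apply: sqr_le_mul_of_quadratic_ge0 => t.
have := Ap (u + t *: w).
rewrite mulmxDr -scalemxAr dotDl !dotDr !dotZl !dotZr.
rewrite (dot_mulmx w) As (dotC _ u); lra.
Qed.

(** Cauchy-Schwarz against a unit vector; later it turns bounds on the quadratic form of [X] into
    bounds on single voltages. *)
Lemma psd_entry_sqr_le A : A^T = A -> (forall w, 0 <= dot w (A *m w)) ->
  forall w i, (A *m w) i 0 ^+ 2 <= A i i * dot w (A *m w).
Proof.
move=> As Ap w i; have := psd_cauchy_schwarz As Ap (delta_mx i 0) w.
by rewrite dot_delta dot_delta_mulmx.
Qed.

Definition sum_sqr A : R := \sum_i \sum_j A i j ^+ 2.

Lemma sum_sqr_ge0 A : 0 <= sum_sqr A.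
Proof. by do 2 (apply: sumr_ge0 => ? _); exact: sqr_ge0. Qed.

Lemma dot_mulmx_le_sum_sqr A w :
  dot (A *m w) (A *m w) <= sum_sqr A * dot w w.
Proof.
rewrite mulr_suml; apply: ler_sum => i _; rewrite -expr2 mxE.
apply: le_trans (sum_cauchy_schwarz (fun j => A i j) (fun j => w j 0)) _.
by rewrite /dot; under [X in _ <= _ * X]eq_bigr do rewrite -expr2.
Qed.

End Dot.

Section Rayleigh.
Variables (R : realType) (n : nat).
Implicit Types (w z : 'cV[R]_n) (A X : 'M[R]_n).

Lemma frobenius_norm_ge0 X : 0 <= frobenius_norm X.
Proof. exact: sqrtr_ge0. Qed.

(** Cauchy-Schwarz over the index pairs, then AM-GM. Absolute values are taken entrywise because
    each bus has its own staleness; this is why the Frobenius norm appears. *)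
Lemma frobenius_bilinear_le X w z :
  \sum_i \sum_j `|w i 0| * `|X i j| * `|z j 0|
    <= frobenius_norm X * (dot w w + dot z z) / 2.
Proof.
have F0 := frobenius_norm_ge0 X; have := dot_ge0 w; have := dot_ge0 z => z0 w0.
rewrite -ler_sqr ?nnegrE; last 2 first.
- by do 2 (apply: sumr_ge0 => ? _); rewrite !mulr_ge0.
- by rewrite divr_ge0// mulr_ge0// addr_ge0.
rewrite pair_bigA /=.
have -> : \sum_(p : 'I_n * 'I_n) `|w p.1 0| * `|X p.1 p.2| * `|z p.2 0| =
   \sum_(p : 'I_n * 'I_n) `|X p.1 p.2| * (`|w p.1 0| * `|z p.2 0|).
  by apply: eq_bigr => p _; rewrite mulrCA mulrA.
apply: le_trans (sum_cauchy_schwarz _ _) _.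
have -> : \sum_(p : 'I_n * 'I_n) `|X p.1 p.2| ^+ 2 = frobenius_norm X ^+ 2.
  rewrite sqr_sqrtr; last exact: sum_sqr_ge0.
  by rewrite pair_bigA; apply: eq_bigr => p _; rewrite real_normK ?num_real.
have -> : \sum_(p : 'I_n * 'I_n) (`|w p.1 0| * `|z p.2 0|) ^+ 2 =
   dot w w * dot z z.
  rewrite /dot mulr_suml; under [RHS]eq_bigr do rewrite mulr_sumr.
  rewrite pair_bigA; apply: eq_bigr => p _.
  by rewrite exprMn !real_normK ?num_real.
have := sqr_ge0 (dot w w - dot z z); have := sqr_ge0 (frobenius_norm X).
move: (frobenius_norm X) (dot w w) (dot z z) => F a b; nra.
Qed.

(* m := sup of |X w|^2 over unit w makes B = m - X^T X positive semidefinite   *)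
(* with infimum 0 on the unit sphere; |B w|^2 <= tr(B) w^T B w then prevents B *)
(* from being invertible, so m is an eigenvalue.                               *)
Lemma singular_value_top X : (0 < n)%N -> exists2 s, singular_value X s &
  forall w, dot (X *m w) (X *m w) <= s ^+ 2 * dot w w.
Proof.
move=> n0; set S := [set dot (X *m w) (X *m w) | w in [set w | dot w w = 1]].
have S0 : S !=set0.
  exists (dot (X *m delta_mx (Ordinal n0) 0) (X *m delta_mx (Ordinal n0) 0)).
  by exists (delta_mx (Ordinal n0) 0) => //=; rewrite dot_delta mxE !eqxx.
have Sub : ubound S (sum_sqr X).
  move=> _ [w /= w1 <-]; apply: le_trans (dot_mulmx_le_sum_sqr _ _) _.
  by rewrite w1 mulr1.
have hS : has_sup S by split=> //; exists (sum_sqr X).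
set m := sup S; have m0 : 0 <= m.
  have [y Sy] := S0; apply: le_trans (_ : 0 <= y) _.
    by case: Sy => w _ <-; exact: dot_ge0.
  by apply: sup_upper_bound.
have hm w : dot (X *m w) (X *m w) <= m * dot w w.
  have [w0|w0] := eqVneq (dot w w) 0.
    by have := dot_mulmx_le_sum_sqr X w; rewrite w0 !mulr0.
  have wp : 0 < dot w w by rewrite lt_def w0 dot_ge0.
  set c := (Num.sqrt (dot w w))^-1.
  have c2 : c * c = (dot w w)^-1 by rewrite -invfM -expr2 sqr_sqrtr ?dot_ge0.
  have : S (dot (X *m (c *: w)) (X *m (c *: w))).
    by exists (c *: w) => //=; rewrite dotZl dotZr mulrA c2 mulVf.
  move=> /(sup_upper_bound hS); rewrite -/m -scalemxAr dotZl dotZr mulrA c2.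
  by rewrite ler_pdivrMl// mulrC.
exists (Num.sqrt m); last by move=> w; rewrite sqr_sqrtr.
split; first exact: sqrtr_ge0.
rewrite sqr_sqrtr// /eigenvalue /eigenspace kermx_eq0 row_free_unit.
apply/negP => Bu'; set B := m%:M - X^T *m X.
have Bu : B \in unitmx.
  by rewrite /B -opprB -scaleN1r unitmxZ ?unitrN1.
have BQ w : dot w (B *m w) = m * dot w w - dot (X *m w) (X *m w).
  by rewrite mulmxBl mul_scalar_mx dotBr dotZr -mulmxA dot_mulmx trmxK.
have Bs : B^T = B by rewrite linearB /= tr_scalar_mx trmx_mul trmxK.
have Bp w : 0 <= dot w (B *m w) by rewrite BQ subr_ge0.
have BB w : dot (B *m w) (B *m w) <= \tr B * dot w (B *m w).
  rewrite mulr_suml; apply: ler_sum => i _; rewrite -expr2.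
  exact: psd_entry_sqr_le.
(* Since [w = invmx B *m (B *m w)], the form of [B] stays above [1 / K] on the unit sphere, against
   its infimum [0]; [K + 1] avoids dividing by zero. *)
set K := sum_sqr (invmx B) * \tr B.
have hK w : dot w w = 1 -> 1 <= K * (m - dot (X *m w) (X *m w)).
  move=> w1; rewrite -w1 -{1 2}(mulKmx Bu w).
  apply: le_trans (dot_mulmx_le_sum_sqr _ _) _; rewrite -mulrA.
  apply: ler_wpM2l; first exact: sum_sqr_ge0.
  by rewrite -[m]mulr1 -w1 -BQ.
have K0 : 0 <= K.
  apply: mulr_ge0; first exact: sum_sqr_ge0.
  by apply: sumr_ge0 => i _; rewrite -dot_delta_mulmx.
have d0 : 0 < (K + 1)^-1 by rewrite invr_gt0 ltr_wpDl.
have [_ [w /= w1 <-]] := sup_adherent d0 hS; rewrite -/m => hw.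
have := hK w w1; apply/negP; rewrite -ltNge.
set d := m - _; have hd : d < (K + 1)^-1 by rewrite /d; lra.
apply: le_lt_trans (_ : K * (K + 1)^-1 < 1).
  by apply: ler_wpM2l => //; exact: ltW.
by rewrite ltr_pdivrMr ?mul1r ?ltrDl// ltr_wpDl.
Qed.

(** The Frobenius norm bounds all singular values, so the [sup] is a genuine supremum and not a
    default value. *)
Lemma singular_value_le_sigma_max X s : singular_value X s -> s <= sigma_max X.
Proof.
move=> hs; apply: ub_le_sup hs.
exists (frobenius_norm X) => r [r0 /eigenvalueP [v vX vN0]].
rewrite -ler_sqr ?nnegrE ?frobenius_norm_ge0// sqr_sqrtr; last exact: sum_sqr_ge0.
have vp : 0 < dot v^T v^T.
  rewrite lt_def dot_ge0 andbT; apply: contraNneq vN0 => /eqP.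
  rewrite psumr_eq0 => [/allP h|i _]; last by rewrite -expr2 sqr_ge0.
  apply/eqP/rowP => i; have := h i (mem_index_enum i).
  by rewrite !mxE mulf_eq0 orbb => /eqP.
rewrite -(ler_pM2r vp) -dotZr -/(sum_sqr X).
rewrite -linearZ/= -vX !trmx_mul trmxK -mulmxA dot_mulmx trmxK.
exact: dot_mulmx_le_sum_sqr.
Qed.

Lemma sigma_max_ge0 X : (0 < n)%N -> 0 <= sigma_max X.
Proof.
move=> /(singular_value_top X) [s sX _].
by case: (sX) => s0 _; apply: le_trans s0 _; exact: singular_value_le_sigma_max.
Qed.

(** Cauchy-Schwarz between [w] and [X *m w], whose norm the top singular value controls. *)
Lemma rayleigh_le_sigma_max X w : (0 < n)%N ->
  dot w (X *m w) <= sigma_max X * dot w w.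
Proof.
move=> n0; have [s sX hs] := singular_value_top X n0.
have s0 : 0 <= s by case: sX.
apply: le_trans (_ : s * dot w w <= _); last first.
  by apply: ler_wpM2r; [exact: dot_ge0|exact: singular_value_le_sigma_max].
have [|neg] := leP 0 (dot w (X *m w)); last first.
  by apply: le_trans (ltW neg) _; rewrite mulr_ge0 ?dot_ge0.
move=> pos; rewrite -ler_sqr ?nnegrE ?mulr_ge0 ?dot_ge0//.
apply: le_trans (sum_cauchy_schwarz _ _) _.
have sq (z : 'cV[R]_n) : \sum_i z i 0 ^+ 2 = dot z z.
  by apply: eq_bigr => i _; rewrite expr2.
rewrite !sq exprMn (expr2 (dot w w)) mulrA mulrC; apply: ler_wpM2r => //.
exact: dot_ge0.
Qed.

End Rayleigh.

(** * The reactance matrix of a tree is positive definite *)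

Section Tree.
Variables (n : nat) (E : {set line n}).
Hypothesis treeE : is_tree E.
Let adj := Defs.adjacent E.

Lemma adjacent_sym : symmetric adj.
Proof.
move=> h k; rewrite /adj /Defs.adjacent; congr (_ \in E).
by rewrite [LHS]finset.setUC.
Qed.

Lemma rev_path_adjacent h p : path adj h p -> path adj (last h p) (rev (belast h p)).
Proof.
by move=> hp; rewrite rev_path (eq_path (e' := adj))// => a b; rewrite adjacent_sym.
Qed.

(* At the first divergence, following both paths until they meet again closes  *)
(* a cycle with at least three buses.                                          *)
Lemma tree_path_uniq h p p' : path adj h p -> path adj h p' ->
  uniq (h :: p) -> uniq (h :: p') -> last h p = last h p' -> p = p'.
Proof.
case: treeE => _ _ acyclic.
elim: p h p' => [|a p1 IH] h [|b p2] //.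
- by move=> _ _ _ /= /andP[/negP h1 _] hb; case: h1; rewrite hb mem_last.
- by move=> _ _ /= /andP[/negP h1 _] _ hb; case: h1; rewrite -hb mem_last.
move=> /= /andP[ha pa] /andP[hb pb] /andP[hp ua] /andP[hp' ub] hl.
have [ab|ab] := eqVneq a b.
  by rewrite -ab in pb ub hl *; rewrite (IH a p2).
exfalso.
have hasz : has (mem (b :: p2)) (a :: p1).
  by apply/hasP; exists (last a p1); rewrite ?mem_last// hl /= mem_last.
have aa : path adj h (a :: p1) by rewrite /= ha.
have bb : path adj h (b :: p2) by rewrite /= hb.
have hab : head h (a :: p1) != head h (b :: p2) by [].
have uaa : uniq (h :: a :: p1) by rewrite /= hp.
have ubb : uniq (h :: b :: p2) by rewrite /= hp'.
move: hab aa bb uaa ubb.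
(* [z] is the first bus of the one path lying on the other; [u] and [v] are the disjoint stretches
   from [h] to [z]. *)
case: (split_find hasz) => z u w zb unb.
have zb' : z \in b :: p2 by [].
case/splitPr: zb' unb => v w' unb ab'.
rewrite cat_rcons !cat_path /= => /and3P[hu uz _] /and3P[hv vz _] uu uv.
have cyc : cycle adj (h :: u ++ z :: rev v).
  rewrite /= rcons_cat cat_path hu /= uz /=.
  have : path adj h (rcons v z) by rewrite rcons_path hv.
  by move=> /rev_path_adjacent; rewrite last_rcons belast_rcons rev_cons.
have := acyclic (h :: u ++ z :: rev v); rewrite /ucycle cyc /=.
move: uu uv; rewrite !mem_cat !cat_uniq !inE /= !negb_or !mem_rev !rev_uniq.
move=> /andP[/and3P[hNu hz _] /and3P[uu /andP[zu _] _]].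
move=> /andP[/and3P[hNv _ _] /and3P[uv /andP[zv _] _]].
rewrite hNu hz hNv uu uv (negPf zu) zv has_rev /= andbT.
have -> : has (mem u) v = false.
  apply/negbTE; apply: contra unb => /hasP[y yv yu]; apply/hasP; exists y => //.
  by rewrite /= mem_cat yv.
rewrite size_cat /= size_rev => /(_ isT) sz.
(* A closed walk of at most two buses leaves only [h] and [z], so both paths start with [z], against
   [a != b]. *)
have [] : u = [::] /\ v = [::] by case: (u) (v) sz => [|? ?] [|? ?]; rewrite //= ?addSn ?addnS.
by move=> u0 v0; rewrite u0 v0 /= eqxx in ab'.
Qed.

Definition edge_seq (h : 'I_n.+1) p : seq (line n) :=
  pairmap (fun h k => [set h; k]%SET : line n) h p.

Lemma edge_seq_rcons h p k :
  edge_seq h (rcons p k) = rcons (edge_seq h p) [set last h p; k]%SET.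
Proof. by elim: p h => [|a p IH] h //=; rewrite IH. Qed.

Lemma root_linesE j p : is_root_path E j p ->
  root_lines E j = [set l | l \in edge_seq ord0 p]%SET.
Proof.
move=> [pp up lp]; apply/finset.setP => l; rewrite !inE.
apply/asboolP/idP => [[p' [pp' up' lp'] lin]|lin]; last by exists p.
by rewrite (tree_path_uniq pp pp') ?lp.
Qed.

Lemma root_path_exists j : exists p, is_root_path E j p.
Proof.
case: treeE => _ /(_ ord0 j) /connectP[p pp jp] _.
case: (shortenP pp) jp => p' pp' up' _ jp.
by exists p'; split.
Qed.

Lemma edge_seq_sub h p l : path adj h p -> l \in edge_seq h p -> l \in E.
Proof.
elim: p h => [|k p IH] h //= /andP[hk kp]; rewrite in_cons => /orP[/eqP->|].
  exact: hk.
exact: IH.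
Qed.

Lemma root_lines_sub j : {subset root_lines E j <= E}.
Proof.
have [p rp] := root_path_exists j; case: (rp) => pp _ _ l.
by rewrite (root_linesE rp) inE => /edge_seq_sub; exact.
Qed.

Lemma set2_inj (h k a b : 'I_n.+1) : [set h; k]%SET = [set a; b]%SET ->
  (h = a /\ k = b) \/ (h = b /\ k = a).
Proof.
move=> e.
have /set2P ha : h \in [set a; b]%SET by rewrite -e set21.
have /set2P ka : k \in [set a; b]%SET by rewrite -e set22.
have /set2P ah : a \in [set h; k]%SET by rewrite e set21.
have /set2P bh : b \in [set h; k]%SET by rewrite e set22.
by case: ha ka ah bh => ? [] ? [] ? [] ?;
  (by left; split; congruence) || (by right; split; congruence).
Qed.

Lemma mem_edge_seq h p l : l \in edge_seq h p ->
  exists p1 k p2, p = p1 ++ k :: p2 /\ l = [set last h p1; k]%SET.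
Proof.
elim: p h => [|k p IH] h //=; rewrite in_cons => /orP[/eqP->|/IH[p1 [k' [p2 [-> ->]]]]].
  by exists [::], k, p.
by exists (k :: p1), k', p2.
Qed.

(** If the path to [k] crosses the line from [a] to [i], its prefix is the path to [i], and it
    continues since [k != i]. Crossing from [i] to [a] would visit [a] twice. *)
Lemma last_line_depth i k p a pk : is_root_path E i (rcons p i) ->
  a = last ord0 p -> is_root_path E k pk -> [set a; i]%SET \in root_lines E k ->
  k != i -> (size (rcons p i) < size pk)%N.
Proof.
move=> [pp up _] ap rk; case: (rk) => pk1 uk lk; rewrite (root_linesE rk) inE.
move=> /mem_edge_seq[p1 [b [p2 [pke]]]] /set2_inj [[e1 e2]|[e1 e2]] ki.
  subst b; rewrite pke -cat_rcons in pk1 uk lk *.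
  have -> : rcons p i = rcons p1 i.
    apply: (@tree_path_uniq ord0) => //; rewrite ?last_rcons//.
      by move: pk1; rewrite cat_path => /andP[].
    by move: uk; rewrite -cat_cons cat_uniq => /andP[].
  case: p2 lk {pke pk1 uk} => [|c p2 _]; last by rewrite size_cat /= addnS ltnS leq_addr.
  by rewrite cats0 last_rcons => ik; rewrite ik eqxx in ki.
exfalso; subst b; rewrite pke in pk1 uk.
have p1E : rcons p i = p1.
  apply: (@tree_path_uniq ord0) => //; rewrite ?last_rcons//.
    by move: pk1; rewrite cat_path => /andP[].
  by move: uk; rewrite -cat_cons cat_uniq => /andP[].
have : a \in ord0 :: p1 by rewrite -p1E ap -rcons_cons mem_rcons inE mem_last orbT.
move: uk; rewrite -cat_cons cat_uniq /= => /and3P[_ /norP[/negP h _] _].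
by move/h.
Qed.

End Tree.

Section Reactance.
Variables (R : realType) (n : nat) (E : {set line n}) (x : line n -> R).
Hypothesis treeE : is_tree E.
Hypothesis x_gt0 : forall l : line n, l \in E -> 0 < x l.
Let X := reactance_matrix E x.
Let P (i : 'I_n) := root_lines E (lift ord0 i).

Lemma reactance_matrix_sym : X^T = X.
Proof. by apply/matrixP => i j; rewrite !mxE finset.setIC. Qed.

(** Exchanging sums: a line contributes for every pair of buses whose root paths both use it, which
    makes the square of the total injection below that line. *)
Lemma reactance_quadE (w : 'cV[R]_n) :
  dot w (X *m w) = 2 * \sum_(l in E) x l * (\sum_(i | l \in P i) w i 0) ^+ 2.
Proof.
have -> : dot w (X *m w) = \sum_i \sum_j \sum_(l in E)
    (if (l \in P i) && (l \in P j) then 2 * (x l * (w i 0 * w j 0)) else 0).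
  apply: eq_bigr => i _; rewrite mxE mulr_sumr; apply: eq_bigr => j _.
  rewrite mxE -mulrA mulrCA mulr_suml !mulr_sumr -big_mkcondr /=.
  apply: eq_big => l; last by move=> _; ring.
  rewrite finset.in_setI; apply/idP/andP => [h|[]//]; split => //.
  by case/andP: h => /(root_lines_sub treeE).
under eq_bigr do rewrite exchange_big /=.
rewrite exchange_big /= mulr_sumr; apply: eq_bigr => l _.
rewrite expr2 mulr_suml !mulr_sumr [RHS]big_mkcond/=; apply: eq_bigr => i _.
case: ifP => li; last by rewrite big1.
rewrite !mulr_sumr [RHS]big_mkcond; apply: eq_bigr => j _ /=.
by [].
Qed.

Lemma reactance_quad_ge0 (w : 'cV[R]_n) : 0 <= dot w (X *m w).
Proof.
rewrite reactance_quadE mulr_ge0// sumr_ge0// => l /x_gt0 /ltW xl.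
by rewrite mulr_ge0// sqr_ge0.
Qed.

(* Among the buses with a nonzero entry take a deepest one: the last line on   *)
(* its root path is used by no other such bus.                                 *)
Lemma reactance_quad_eq0 (w : 'cV[R]_n) : dot w (X *m w) = 0 -> w = 0.
Proof.
rewrite reactance_quadE => /eqP; rewrite mulf_eq0 pnatr_eq0 /= => w0.
have hl l : l \in E -> \sum_(i | l \in P i) w i 0 = 0.
  move=> lE; move: w0; rewrite psumr_eq0 => [/allP/(_ l (mem_index_enum l))|k /x_gt0 /ltW xk].
    by rewrite lE /= mulf_eq0 (gt_eqF (x_gt0 lE)) /= sqrf_eq0 => /eqP.
  by rewrite mulr_ge0// sqr_ge0.
have [p hp] := choice (fun i : 'I_n => root_path_exists treeE (lift ord0 i)).
apply/eqP; apply: contraT => wN0.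
have [i0 wi0] : exists i, w i 0 != 0.
  apply/existsP; apply: contraNT wN0; rewrite negb_exists => /forallP h.
  by apply/eqP/colP => i; have := h i; rewrite negbK mxE => /eqP.
have [i wi imax] := @arg_maxnP _ i0 (fun i => w i 0 != 0) (fun i => size (p i)) wi0.
have pi0 : p i != [::].
  apply/eqP => e; have [_ _] := hp i; rewrite e /= => e0.
  by have := neq_lift ord0 i; rewrite -e0 eqxx.
have [pp pe] : exists pp, p i = rcons pp (lift ord0 i).
  have [_ _] := hp i; case/lastP: (p i) pi0 => // s y _; rewrite last_rcons => ->.
  by exists s.
have hpi := hp i; rewrite pe in hpi.
set l := ([set last ord0 pp; lift ord0 i]%SET : line n).
have lPi : l \in P i.
  by rewrite /P (root_linesE treeE hpi) inE edge_seq_rcons mem_rcons mem_head.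
have := hl l (root_lines_sub treeE lPi).
rewrite (bigD1 i)//= big1 ?addr0 => [h|k /andP[lk ki]]; first by rewrite h eqxx in wi.
apply/eqP; apply: contraT => wk.
have : (size (p k) <= size (p i))%N by exact: imax.
rewrite pe leqNgt (last_line_depth treeE hpi (erefl _) (hp k) lk)//.
Qed.

End Reactance.

(** * KKT points *)

Section Optimality.
Variables (R : realType) (n : nat) (X : 'M[R]_n) (vpar vlo vup : 'cV[R]_n).
Hypothesis X_sym : X^T = X.
Hypothesis X_ge0 : forall w : 'cV[R]_n, 0 <= dot w (X *m w).
Hypothesis X_eq0 : forall w : 'cV[R]_n, dot w (X *m w) = 0 -> w = 0.
Implicit Types a b q : 'cV[R]_n.

(** Here [a] and [b] are the multipliers of the upper and lower limits; stationarity of the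
    Lagrangian has already replaced the primal variable by [b - a]. *)
Definition kkt a b :=
  [/\ le_vec 0 a, le_vec 0 b, primal_feasible X vpar vlo vup (b - a) &
      forall i, a i 0 * (vup i 0 - (X *m (b - a) + vpar) i 0) = 0 /\
                b i 0 * ((X *m (b - a) + vpar) i 0 - vlo i 0) = 0].

Lemma quad_expand q d : dot (q + d) (X *m (q + d)) =
  dot q (X *m q) + 2 * dot d (X *m q) + dot d (X *m d).
Proof.
by rewrite mulmxDr !dotDl !dotDr (dot_mulmx q X d) X_sym (dotC (X *m q)); ring.
Qed.

Lemma pd_unitmx : X \in unitmx.
Proof.
rewrite -row_free_unit -kermx_eq0; apply/negPn/negP => /rowV0Pn[v /sub_kermxP vX].
suff vT0 : v^T = 0 by rewrite -(trmxK v) vT0 trmx0 eqxx.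
apply: X_eq0; rewrite dot_mulmx -trmx_mul vX trmx0 /dot big1// => i _.
by rewrite mxE mul0r.
Qed.

(** The variational inequality at a KKT point, bus by bus: a positive multiplier pins the voltage to
    its limit, which the voltage of [q] can only leave inwards. *)
Lemma kkt_feasible_dot_ge0 a b q : kkt a b -> primal_feasible X vpar vlo vup q ->
  0 <= dot (b - a) (X *m (q - (b - a))).
Proof.
move=> [a0 b0 _ cs] [qup qlo]; apply: sumr_ge0 => i _.
have [csa csb] := cs i; move: (a0 i) (b0 i) (qup i) (qlo i) csa csb.
have -> : (b - a) i 0 = b i 0 - a i 0 by rewrite !mxE.
have -> : (X *m (q - (b - a))) i 0 =
    (X *m q + vpar) i 0 - (X *m (b - a) + vpar) i 0.
  by rewrite (mulmxBr X q) !mxE; ring.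
rewrite [(0 : 'cV_n) i 0]mxE; nra.
Qed.

Lemma kkt_primal_optimizer a b : kkt a b ->
  primal_optimizer X vpar vlo vup (b - a) /\
  forall q, primal_optimizer X vpar vlo vup q -> q = b - a.
Proof.
move=> k; have [_ _ feas _] := k.
have obj q : primal_feasible X vpar vlo vup q ->
   2^-1 * dot (q - (b - a)) (X *m (q - (b - a))) <=
   primal_objective X q - primal_objective X (b - a).
  move=> /(kkt_feasible_dot_ge0 k); rewrite /primal_objective -!mulmxA !dotE.
  have := quad_expand (b - a) (q - (b - a)); rewrite subrKC => ->.
  by rewrite dot_mulmx X_sym dotC; lra.
split=> [|q [qf qopt]].
  split=> // q qf; have := obj q qf; have := X_ge0 (q - (b - a)); lra.
apply/eqP; rewrite -subr_eq0; apply/eqP/X_eq0/eqP; rewrite eq_le X_ge0 andbT.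
have := obj q qf; have := qopt _ feas; lra.
Qed.

(** An exact second-order expansion; complementarity at [(a, b)] reduces its linear part to the
    products of the new multipliers with the slacks. *)
Lemma kkt_dual_objective a b a' b' : kkt a b ->
  dual_objective X vpar vlo vup a' b' =
  dual_objective X vpar vlo vup a b
  - 2^-1 * dot ((b' - a') - (b - a)) (X *m ((b' - a') - (b - a)))
  - \sum_i (a' i 0 * (vup i 0 - (X *m (b - a) + vpar) i 0) +
            b' i 0 * ((X *m (b - a) + vpar) i 0 - vlo i 0)).
Proof.
move=> [_ _ _ cs]; rewrite /dual_objective -!mulmxA !dotE.
have -> : \sum_i (a' i 0 * (vup i 0 - (X *m (b - a) + vpar) i 0) +
            b' i 0 * ((X *m (b - a) + vpar) i 0 - vlo i 0)) =
  dot (a' - a) (vup - (X *m (b - a) + vpar)) +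
  dot (b' - b) (X *m (b - a) + vpar - vlo).
  rewrite /dot -big_split; apply: eq_bigr => i _; have := cs i; rewrite !mxE.
  by move=> [h1 h2] /=; move: h1 h2; lra.
have -> : b' - a' - (b - a) = (b' - b) - (a' - a) 
  by apply/colP => i; rewrite !mxE; ring.
have -> : b' - a' = b - a + ((b' - b) - (a' - a)).
  by apply/colP => i; rewrite !mxE; ring.
rewrite quad_expand.
have -> : dot a' (vpar - vup) = dot a (vpar - vup) + dot (a' - a) (vpar - vup).
  by rewrite -dotDl subrKC.
have -> : dot b' (vlo - vpar) = dot b (vlo - vpar) + dot (b' - b) (vlo - vpar).
  by rewrite -dotDl subrKC.
set da := a' - a; set db := b' - b.
rewrite !(dotDl, dotDr, dotNl, dotNr, dotBl, dotBr, mulmxBr, mulmxDr, mulmxN).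
by field.
Qed.

(** A zero gap fixes [b' - a'] and makes [a'], [b'] complementary to the same voltages. If the
    limits differ, one of them is slack at each bus, so one multiplier is zero and the difference
    gives the other. With equal limits, adding the same amount to both leaves the dual objective
    unchanged. *)
Lemma kkt_dual_optimizer a b : kkt a b ->
  dual_optimizer X vpar vlo vup a b /\
  ((forall i, vlo i 0 < vup i 0) -> forall a' b',
     dual_optimizer X vpar vlo vup a' b' -> a' = a /\ b' = b).
Proof.
move=> k; have [a0 b0 [vu vl] cs] := k.
have s0 a' b' : dual_feasible a' b' -> forall i,
    0 <= a' i 0 * (vup i 0 - (X *m (b - a) + vpar) i 0) /\
    0 <= b' i 0 * ((X *m (b - a) + vpar) i 0 - vlo i 0).
  move=> [a'0 b'0] i; move: (a'0 i) (b'0 i); rewrite !(mxE const_mx_key).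
  by move=> h1 h2; rewrite !mulr_ge0// subr_ge0.
have s1 a' b' : dual_feasible a' b' ->
    0 <= \sum_i (a' i 0 * (vup i 0 - (X *m (b - a) + vpar) i 0) +
            b' i 0 * ((X *m (b - a) + vpar) i 0 - vlo i 0)).
  by move=> f; apply: sumr_ge0 => i _; rewrite addr_ge0//; have [] := s0 _ _ f i.
split=> [|vlt a' b' [f opt]].
  split=> // a' b' f; rewrite (kkt_dual_objective a' b' k).
  have := s1 _ _ f; have := X_ge0 (b' - a' - (b - a)); lra.
have ab : dual_feasible a b by [].
have := opt _ _ ab; rewrite (kkt_dual_objective a' b' k).
have := s1 _ _ f; have := X_ge0 (b' - a' - (b - a)) => h1 h2 h3.
have /X_eq0 dm : dot (b' - a' - (b - a)) (X *m (b' - a' - (b - a))) = 0 by lra.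
have /eqP : \sum_i (a' i 0 * (vup i 0 - (X *m (b - a) + vpar) i 0) +
            b' i 0 * ((X *m (b - a) + vpar) i 0 - vlo i 0)) = 0 by lra.
rewrite psumr_eq0 => [/allP hs|i _]; last by rewrite addr_ge0//; have [] := s0 _ _ f i.
suff e i : a' i 0 = a i 0 /\ b' i 0 = b i 0.
  by split; apply/colP => i; have [] := e i.
have := hs i (mem_index_enum i); have [p1 p2] := s0 _ _ f i.
rewrite paddr_eq0// => /andP[/eqP c1 /eqP c2]; have [c3 c4] := cs i.
have := vlt i; have /colP/(_ i) := dm; rewrite !mxE => e.
move: c1 c2 c3 c4; rewrite !mxE; set v := \sum_j _ + _ => c1 c2 c3 c4 lt.
have [vv|vv] := eqVneq v (vlo i 0).
  have hN : vup i 0 - v != 0 by rewrite vv subr_eq0 gt_eqF.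
  move/eqP: c1; move/eqP: c3; rewrite !mulf_eq0 !(negPf hN) !orbF => /eqP z1 /eqP z2.
  by split; lra.
have hN : v - vlo i 0 != 0 by rewrite subr_eq0.
move/eqP: c2; move/eqP: c4; rewrite !mulf_eq0 !(negPf hN) !orbF => /eqP z1 /eqP z2.
by split; lra.
Qed.

End Optimality.

(** * Real sequences and projections *)

Section Sequences.
Variable R : realType.
Implicit Types (u : nat -> R).

Lemma cvgn_distP u (l : R) : (u t @[t --> \oo] --> l) <->
  (forall e, 0 < e -> exists N, forall t, (N <= t)%N -> `|u t - l| <= e).
Proof.
split=> [/cvgrPdist_le h e e0|h].
  have [N _ hN] := h e e0; exists N => t Nt; rewrite distrC; exact: hN.
apply/cvgrPdist_le => e e0; have [N hN] := h e e0.
by exists N => // t Nt; rewrite distrC; exact: hN.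
Qed.

Lemma cvgn_unique u (l l' : R) :
  u t @[t --> \oo] --> l -> u t @[t --> \oo] --> l' -> l = l'.
Proof. exact: norm_cvg_unique. Qed.

Lemma finite_eventually (I : finType) (P : I -> nat -> Prop) :
  (forall i, exists N, forall t, (N <= t)%N -> P i t) ->
  exists N, forall t, (N <= t)%N -> forall i, P i t.
Proof.
move=> /choice[N hN]; exists (\max_i N i)%N => t ht i.
by apply: hN; apply: leq_trans ht; exact: leq_bigmax.
Qed.

Lemma cauchy_distP u :
  (forall e, 0 < e -> exists N, forall s t, (N <= s)%N -> (N <= t)%N ->
     `|u t - u s| <= e) ->
  exists l : R, u t @[t --> \oo] --> l.
Proof.
move=> h; apply/cvg_ex/cauchy_cvgP/cauchy_exP => e e0.
have [N hN] := h (e / 2) (divr_gt0 e0 (ltr0n _ 2)).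
exists (u N), N => // t Nt; rewrite /ball /= distrC.
by apply: le_lt_trans (hN _ _ (leqnn N) Nt) _; lra.
Qed.

(** A bounded monotone [Phi] converges, so its decrements, which dominate [c * N t], tend to
    zero. *)
Lemma nonincreasing_summand_cvg0 (Phi N : nat -> R) (c E0 : R) t0 : 0 < c ->
  (forall t, 0 <= N t) ->
  (forall t, (t0 <= t)%N -> E0 <= Phi t) ->
  (forall t, (t0 <= t)%N -> Phi t.+1 <= Phi t - c * N t) ->
  N t @[t --> \oo] --> (0 : R).
Proof.
move=> c0 N0 lb dec.
pose u t := Phi (t + t0)%N.
have ud : nonincreasing_seq u.
  apply/nonincreasing_seqP => t; rewrite /u addSn; apply: le_trans (dec _ _) _.
    by rewrite leq_addl.
  by rewrite gerBl mulr_ge0// ltW.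
have uc : cvgn u.
  apply: nonincreasing_is_cvgn => //; exists E0 => _ [t _ <-].
  by apply: lb; rewrite leq_addl.
rewrite -(cvg_shiftn t0) /=.
apply: (@squeeze_cvgr _ _ _ _ (fun=> 0) (fun t => c^-1 * (u t - u t.+1))).
- near=> t; rewrite N0 /= -ler_pdivrMl ?invr_gt0// invrK lerBrDr.
  by rewrite addrC -lerBrDr dec// leq_addl.
- exact: cvg_cst.
- have -> : (0 : R) = c^-1 * (limn u - limn u) by rewrite subrr mulr0.
  apply: cvgMr; apply: cvgB => //; by rewrite (cvg_shiftS u).
Unshelve. all: by end_near.
Qed.

Lemma sum_ord_mono (F : nat -> R) k B : (k <= B)%N -> (forall i, 0 <= F i) ->
  \sum_(i < k) F i <= \sum_(i < B) F i.
Proof.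
move=> kB F0; rewrite -(subnKC kB); elim: (B - k)%N => [|d IH]; first by rewrite addn0.
by rewrite addnS big_ord_recr /=; apply: le_trans IH _; rewrite lerDl.
Qed.

Lemma dist_le_sum_increments u t k : (k <= t)%N ->
  `|u t - u (t - k)%N| <= \sum_(i < k) `|u (t - i.+1).+1 - u (t - i.+1)%N|.
Proof.
elim: k => [|k IH] kt; first by rewrite subn0 subrr normr0 big_ord0.
rewrite big_ord_recr /=.
have -> : u t - u (t - k.+1)%N =
  (u t - u (t - k)%N) + (u (t - k)%N - u (t - k.+1)%N) by rewrite addrA subrK.
apply: le_trans (ler_normD _ _) _; rewrite lerD ?IH ?(ltnW kt)//.
by rewrite -subnSK.
Qed.

(** When the window moves one step, the newest term enters with weight [B] and each older term loses
    one unit of weight. *)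
Lemma weighted_window_sum (G : nat -> R) B :
  \sum_(k < B) (B - k)%:R * G k - \sum_(k < B) (B - k)%:R * G k.+1 =
  B%:R * G 0%N - \sum_(k < B) G k.+1.
Proof.
elim: B => [|B IH]; first by rewrite !big_ord0 mul0r.
have e (H : nat -> R) : \sum_(k < B.+1) (B.+1 - k)%:R * H k =
    \sum_(k < B) (B - k)%:R * H k + \sum_(k < B.+1) H k.
  rewrite !big_ord_recr /= subSnn mul1r addrA; congr (_ + _).
  rewrite -big_split; apply: eq_bigr => k _ /=.
  by rewrite subSn 1?ltnW// -natr1 mulrDl mul1r.
rewrite !e (e (fun k => G k.+1)) (big_ord_recl B (fun k => G k)) /=.
rewrite (big_ord_recr B (fun k => G k.+1)) /= -natr1.
move: IH; set s1 := \sum_(k < B) _ * G k; lra.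
Qed.

Lemma projected_step_sqr_le (a g : R) : 0 <= a ->
  (Num.max 0 (a + g) - a) ^+ 2 <= (Num.max 0 (a + g) - a) * g.
Proof.
move=> a0; case: (leP 0 (a + g)) => h.
  by rewrite addrAC subrr add0r expr2.
nra.
Qed.

(** The complementarity residual is the negative of a projected gradient step, so small steps mean
    small residuals. *)
Lemma projected_step_residual (a g : R) :
  Num.min a (- g) = a - Num.max 0 (a + g).
Proof. by case: (leP 0 (a + g)) => h; case: (leP a (- g)) => h'; lra. Qed.

Lemma min_dist (x y x' y' : R) :
  `|Num.min x y - Num.min x' y'| <= `|x - x'| + `|y - y'|.
Proof.
have := ler_norm (x - x'); have := ler_norm (y - y').
have := ler_norm (- (x - x')); have := ler_norm (- (y - y')); rewrite !normrN.
have := normr_ge0 (x - x'); have := normr_ge0 (y - y').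
rewrite ler_norml.
case: (leP x y) => h1; case: (leP x' y') => h2 *; apply/andP; split; lra.
Qed.

(** If neither projection is active the sum drops by [d]; otherwise one new multiplier is zero and
    the sum is the absolute difference. *)
Lemma projected_pair_sum (a b g d : R) : 0 <= a -> 0 <= b -> 0 <= d ->
  Num.max 0 (a + (g - d)) + Num.max 0 (b - g) <=
  Num.max (a + b) `|Num.max 0 (b - g) - Num.max 0 (a + (g - d))|.
Proof.
move=> a0 b0 d0; rewrite le_max.
case: (leP 0 (a + (g - d))) => h1; case: (leP 0 (b - g)) => h2; apply/orP.
- by left; lra.
- by right; rewrite sub0r normrN ger0_norm//; lra.
- by right; rewrite subr0 ger0_norm//; lra.
- by left; lra.
Qed.

Lemma projected_pair_sum_ge (a b g : R) :
  a + b <= Num.max 0 (a + g) + Num.max 0 (b - g).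
Proof.
by case: (leP 0 (a + g)) => h1; case: (leP 0 (b - g)) => h2; lra.
Qed.

(** One of [x] and [e * y] is at most [r]; the bound on the other factor then controls the
    product. *)
Lemma approx_complementarity (x y C D e r : R) : 0 < e -> 0 <= x <= C ->
  y <= D -> 0 <= D -> `|Num.min x (e * y)| <= r ->
  x * y <= r * (C / e + D) /\ - y <= r / e.
Proof.
move=> e0 /andP[x0 xC] yD D0; rewrite ler_norml => /andP[h1 h2].
have r0 : 0 <= r by lra.
have C0 : 0 <= C by lra.
have hy : - (r / e) <= y.
  have : - r <= e * y by apply: le_trans h1 _; rewrite ge_min lexx orbT.
  by rewrite -mulNr ler_pdivrMr// mulrC.
split; last by lra.
rewrite mulrDr; have rD : 0 <= r * D by rewrite mulr_ge0.
have rC : 0 <= r * (C / e) by rewrite mulr_ge0// divr_ge0// ltW.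
move: h2; case: (leP x (e * y)) => h3 h2.
  have [y0|y0] := leP 0 y; last by nra.
  have : x * y <= r * D by apply: ler_pM.
  lra.
have hy2 : y <= r / e by rewrite ler_pdivlMr// mulrC.
have [y0|y0] := leP 0 y; last by nra.
have : x * y <= C * (r / e) by apply: ler_pM.
have -> : C * (r / e) = r * (C / e) by rewrite mulrCA.
lra.
Qed.

Lemma approx_monotone (x y y' C D e r : R) : 0 < e -> 0 <= x <= C ->
  y <= D -> 0 <= D -> `|Num.min x (e * y)| <= r -> - y' <= r / e ->
  x * (y - y') <= r * (C / e + D + C / e).
Proof.
move=> e0 xC yD D0 hr y're; have [h1 _] := approx_complementarity e0 xC yD D0 hr.
have r0 : 0 <= r by apply: le_trans hr.
have re : 0 <= r / e by rewrite divr_ge0// ltW.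
have : x * - y' <= C * (r / e) by case/andP: xC => x0 xC; nra.
have -> : C * (r / e) = r * (C / e) by rewrite mulrCA.
lra.
Qed.

Lemma cvgn_min u (w : nat -> R) (l k : R) : u t @[t --> \oo] --> l ->
  w t @[t --> \oo] --> k ->
  Num.min (u t) (w t) @[t --> \oo] --> Num.min l k.
Proof.
move=> ul wk; rewrite minr_absE; under eq_fun do rewrite minr_absE.
apply: cvgM; [|exact: cvg_cst]; apply: cvgB; first exact: cvgD.
by apply: cvg_norm; apply: cvgB.
Qed.

Lemma min_eq0_complementary (x y : R) : Num.min x y = 0 ->
  [/\ 0 <= x, 0 <= y & x * y = 0].
Proof.
case: (leP x y) => [h x0|/ltW h y0].
  by rewrite x0 in h *; rewrite mul0r.
by rewrite y0 in h *; rewrite mulr0.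
Qed.

Lemma cvgn_sum (I : finType) (f : I -> nat -> R) (l : I -> R) :
  (forall i, f i t @[t --> \oo] --> l i) ->
  \sum_i f i t @[t --> \oo] --> \sum_i l i.
Proof. by move=> h; apply: cvg_big => //; exact: add_continuous. Qed.

Lemma cvgn_mulmx n (A : 'M[R]_n) (u : nat -> 'cV[R]_n) (l : 'cV[R]_n) :
  (forall j, u t j 0 @[t --> \oo] --> l j 0) ->
  forall i, (A *m u t) i 0 @[t --> \oo] --> (A *m l) i 0.
Proof.
move=> h i; rewrite mxE; under eq_fun do rewrite mxE.
by apply: cvgn_sum => j; apply: cvgMr; exact: h.
Qed.

Lemma cvgn_matrix m n (u : nat -> 'M[R]_(m, n)) (l : 'M[R]_(m, n)) :
  (forall i j, u t i j @[t --> \oo] --> l i j) -> u t @[t --> \oo] --> l.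
Proof.
move=> h; apply/cvg_mx_entourageP => A eA.
have [N hN] : exists N, forall t, (N <= t)%N ->
    forall p : 'I_m * 'I_n, A (l p.1 p.2, u t p.1 p.2).
  apply: finite_eventually => -[i j]; have /cvg_entourageP/(_ _ eA) := h i j.
  by case=> N _ hN; exists N => t /hN.
by exists N => // t /hN hA i j; apply/mem_set; exact: (hA (i, j)).
Qed.

Lemma min_cvg0_left u (w : nat -> R) (l : R) : 0 < l ->
  Num.min (u t) (w t) @[t --> \oo] --> (0 : R) -> w t @[t --> \oo] --> l ->
  u t @[t --> \oo] --> (0 : R).
Proof.
move=> l0 /cvgn_distP h1 /cvgn_distP h2; apply/cvgn_distP => e e0.
have l3 : 0 < l / 3 by lra.
have e1 : 0 < Num.min e (l / 3) by rewrite lt_min e0.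
have [N1 hN1] := h1 _ e1; have [N2 hN2] := h2 _ l3.
exists (maxn N1 N2) => t; rewrite geq_max => /andP[t1 t2].
have := hN1 t t1; have := hN2 t t2; rewrite !subr0 le_min => hw /andP[hm hm3].
move: hw; rewrite ler_norml => /andP[hw _].
have hwl : 2 * l / 3 <= w t by lra.
move: hm hm3; case: (leP (u t) (w t)) => // h4 _; rewrite ler_norml; lra.
Qed.

End Sequences.

(** * Asynchronous projected ascent with bounded staleness *)

Section AsynchronousAscent.
Variables (R : realType) (n : nat) (X : 'M[R]_n) (vpar vlo vup : 'cV[R]_n).
Hypothesis n_gt0 : (0 < n)%N.
Hypothesis X_sym : X^T = X.
Hypothesis X_ge0 : forall w : 'cV[R]_n, 0 <= dot w (X *m w).
Hypothesis X_eq0 : forall w : 'cV[R]_n, dot w (X *m w) = 0 -> w = 0.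
Hypothesis v_le : le_vec vlo vup.
Variables (eps : R) (B K : nat).
Hypothesis eps_gt0 : 0 < eps.
Hypothesis step_small :
  sigma_max X + 2 * frobenius_norm X * B%:R < eps^-1.

(** Minus the dual objective. At voltage [V] its gradient is [vup - V] in [a] and [V - vlo] in
    [b]. *)
Definition energy (a b : 'cV[R]_n) : R :=
  2^-1 * dot (b - a) (X *m (b - a)) + dot a (vup - vpar) - dot b (vlo - vpar).

Lemma energy_expand a b da db :
  energy (a + da) (b + db) = energy a b
   + 2^-1 * dot (db - da) (X *m (db - da))
   - dot da (X *m (b - a) + vpar - vup) - dot db (vlo - (X *m (b - a) + vpar)).
Proof.
rewrite /energy; have -> : b + db - (a + da) = b - a + (db - da).
  by apply/colP => i; rewrite !mxE; ring.
rewrite quad_expand//; set Q := dot (db - da) (X *m (db - da)).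
rewrite !(dotDl, dotDr, dotNl, dotNr); by field.
Qed.

(* The injection that puts every voltage at its lower limit. *)
Let q0 := invmx X *m (vlo - vpar).

(** Completing the square around [q0] leaves only the term [dot a (vup - vlo)], which is
    nonnegative. *)
Lemma energy_lower a b : le_vec 0 a ->
  2^-1 * dot (b - a - q0) (X *m (b - a - q0)) - 2^-1 * dot q0 (X *m q0)
    <= energy a b.
Proof.
move=> a0; have Xu := pd_unitmx X_eq0.
have Xq0 : X *m q0 = vlo - vpar by rewrite /q0 mulKVmx.
have := quad_expand X_sym q0 (b - a - q0); rewrite subrKC /energy => ->.
rewrite Xq0; set Q := dot (b - a - q0) (X *m _).
rewrite (dotBl (b - a)) (dotBl b a).
have : 0 <= dot a (vup - vlo).
  apply: sumr_ge0 => i _; have := a0 i; rewrite !mxE => ai.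
  by rewrite mulr_ge0// subr_ge0.
rewrite !(dotBr a); lra.
Qed.

(* a and b are the multipliers of the upper and lower limits, w t i is the     *)
(* outdated voltage used by bus i in step t, and U t i says that i then acts.  *)
Variables (a b w : nat -> 'cV[R]_n) (U : nat -> 'I_n -> Prop).
Let m t : 'cV[R]_n := b t - a t.
Let V t : 'cV[R]_n := X *m m t + vpar.
Let d t : 'cV[R]_n := m t.+1 - m t.
Let N t : R := dot (a t.+1 - a t) (a t.+1 - a t) + dot (b t.+1 - b t) (b t.+1 - b t).

Hypothesis a_ge0 : forall t, le_vec 0 (a t).
Hypothesis b_ge0 : forall t, le_vec 0 (b t).
Hypothesis idle_step : forall t i, ~ U t i ->
  a t.+1 i 0 = a t i 0 /\ b t.+1 i 0 = b t i 0.
Hypothesis update_step : forall t i, U t i ->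
  a t.+1 i 0 = Num.max 0 (a t i 0 + eps * (w t i 0 - vup i 0)) /\
  b t.+1 i 0 = Num.max 0 (b t i 0 + eps * (vlo i 0 - w t i 0)).
Hypothesis stale : forall t i, (B <= t)%N -> U t i ->
  exists2 r : 'I_n -> nat, (forall j, (t - B <= r j <= t)%N) &
    w t i 0 = \sum_j X i j * m (r j) j 0 + vpar i 0.
Hypothesis frequent : forall t i, exists2 k, (k < K)%N & U (t + k)%N i.

(** * Decrease of the energy under outdated voltages *)

Lemma a_coord_ge0 t i : 0 <= a t i 0. Proof. by have := a_ge0 t i; rewrite mxE. Qed.
Lemma b_coord_ge0 t i : 0 <= b t i 0. Proof. by have := b_ge0 t i; rewrite mxE. Qed.

Lemma m_coordE t i : m t i 0 = b t i 0 - a t i 0. Proof. by rewrite !mxE. Qed.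
Lemma V_coordE t i : V t i 0 = \sum_j X i j * m t j 0 + vpar i 0.
Proof. by rewrite !mxE. Qed.
Lemma d_coordE t i : d t i 0 = m t.+1 i 0 - m t i 0. Proof. by rewrite !mxE. Qed.

Lemma N_ge0 t : 0 <= N t. Proof. by rewrite addr_ge0// dot_ge0. Qed.

Lemma d_le_N t : dot (d t) (d t) <= 2 * N t.
Proof.
rewrite /N /dot -big_split mulr_sumr; apply: ler_sum => i _ /=.
rewrite d_coordE !m_coordE !subvE.
have := sqr_ge0 (b t.+1 i 0 - b t i 0 + (a t.+1 i 0 - a t i 0)).
nra.
Qed.

Lemma stale_error t i : (B <= t)%N -> U t i ->
  `|w t i 0 - V t i 0| <=
    \sum_j `|X i j| * \sum_(k < B) `|d (t - k.+1) j 0|.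
Proof.
move=> Bt /(stale Bt)[r hr ->]; rewrite V_coordE opprD addrACA subrr addr0 -sumrB.
apply: le_trans (ler_norm_sum _ _ _) _; apply: ler_sum => j _.
rewrite -mulrBr normrM ler_wpM2l// distrC.
have /andP[r1 r2] := hr j.
have rE : r j = (t - (t - r j))%N by rewrite subKn.
rewrite {1}rE; apply: le_trans (dist_le_sum_increments (fun t => m t j 0) (leq_subr _ _)) _.
under eq_bigr do rewrite -d_coordE.
apply: (@sum_ord_mono _ (fun k => `|d (t - k.+1) j 0|)) => //.
by rewrite leq_subLR addnC -leq_subLR.
Qed.

(** The projection inequality holds with the outdated voltage [w]; replacing [w] by [V] costs the
    stale error times the change of [m]. *)
Lemma coordinate_descent t i : (B <= t)%N ->
  - ((a t.+1 - a t) i 0 * (V t - vup) i 0) - (b t.+1 - b t) i 0 * (vlo - V t) i 0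
  <= - eps^-1 * ((a t.+1 - a t) i 0 ^+ 2 + (b t.+1 - b t) i 0 ^+ 2)
    + `|d t i 0| * \sum_j `|X i j| * \sum_(k < B) `|d (t - k.+1) j 0|.
Proof.
move=> Bt; rewrite d_coordE !m_coordE !subvE.
have [Ui|/idle_step[-> ->]] := pselect (U t i); last first.
  by rewrite !subrr normr0 !mul0r expr0n /= !addr0 mulr0 oppr0 addr0.
have he := stale_error Bt Ui.
have [ea eb] := update_step Ui.
have := projected_step_sqr_le (eps * (w t i 0 - vup i 0)) (a_coord_ge0 t i).
have := projected_step_sqr_le (eps * (vlo i 0 - w t i 0)) (b_coord_ge0 t i).
rewrite -ea -eb; move: he; set S := \sum_j _.
set x := a t.+1 i 0 - a t i 0; set y := b t.+1 i 0 - b t i 0.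
have -> : b t.+1 i 0 - a t.+1 i 0 - (b t i 0 - a t i 0) = y - x.
  by rewrite /x /y; ring.
move: (V t i 0) (w t i 0) (vup i 0) (vlo i 0) => v z up lo he h1 h2.
have e1 : eps^-1 * x ^+ 2 <= x * (z - up).
  by rewrite ler_pdivrMl// mulrCA.
have e2 : eps^-1 * y ^+ 2 <= y * (lo - z).
  by rewrite ler_pdivrMl// mulrCA.
have e3 : - ((y - x) * (z - v)) <= `|y - x| * S.
  apply: le_trans (ler_norm _) _; rewrite normrN normrM.
  by rewrite ler_wpM2l.
lra.
Qed.

Let F := frobenius_norm X.

Lemma energy_descent t : (B <= t)%N ->
  energy (a t.+1) (b t.+1) <= energy (a t) (b t)
    - (eps^-1 - sigma_max X - F * B%:R) * N t + F * \sum_(k < B) N (t - k.+1).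
Proof.
move=> Bt; have F0 : 0 <= F := frobenius_norm_ge0 X.
rewrite -{1}(subrKC (a t) (a t.+1)) -{1}(subrKC (b t) (b t.+1)) energy_expand.
rewrite -/(m t) -/(V t).
have -> : b t.+1 - b t - (a t.+1 - a t) = d t.
  by apply/colP => i; rewrite !mxE; ring.
have hq : 2^-1 * dot (d t) (X *m d t) <= sigma_max X * N t.
  have := rayleigh_le_sigma_max X (d t) n_gt0; have := d_le_N t.
  have := sigma_max_ge0 X n_gt0; move: (N t) (dot (d t) (d t)) => *; nra.
have hl : - dot (a t.+1 - a t) (V t - vup) - dot (b t.+1 - b t) (vlo - V t) <=
   - eps^-1 * N t + \sum_(k < B) F * (N t + N (t - k.+1)).
  rewrite /dot -!sumrN -big_split /=.
  apply: le_trans (ler_sum _ (fun i _ => coordinate_descent i Bt)) _.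
  rewrite big_split /= -mulr_sumr big_split /=.
  under eq_bigr do rewrite expr2.
  rewrite -/(dot _ _); under [\sum_i _ ^+ 2]eq_bigr do rewrite expr2.
  rewrite -/(dot _ _) lerD2l.
  have -> : \sum_i `|d t i 0| * (\sum_j `|X i j| * \sum_(k < B) `|d (t - k.+1) j 0|)
     = \sum_(k < B) \sum_i \sum_j `|d t i 0| * `|X i j| * `|d (t - k.+1) j 0|.
    rewrite exchange_big; apply: eq_bigr => i _ /=.
    rewrite exchange_big mulr_sumr; apply: eq_bigr => j _ /=.
    by rewrite !mulr_sumr; apply: eq_bigr => k _; rewrite mulrA.
  apply: ler_sum => k _; apply: le_trans (frobenius_bilinear_le _ _ _) _.
  rewrite -mulrA ler_wpM2l//.
  have := d_le_N t; have := d_le_N (t - k.+1); lra.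
have e : \sum_(k < B) F * (N t + N (t - k.+1)) =
   F * B%:R * N t + F * \sum_(k < B) N (t - k.+1).
  rewrite -mulr_sumr big_split /= sumr_const card_ord.
  by rewrite mulrDr -mulrA mulr_natl.
rewrite e in hl; lra.
Qed.

(** The weight [B - k] counts the steps, from [t] on, that can still be charged to the increment of
    step [t - k.+1]. *)
Let Phi t : R := energy (a t) (b t) + F * \sum_(k < B) (B - k)%:R * N (t - k.+1).
Let c : R := eps^-1 - (sigma_max X + 2 * F * B%:R).

Lemma lyapunov_descent t : (B <= t)%N -> Phi t.+1 <= Phi t - c * N t.
Proof.
move=> Bt; have := energy_descent Bt; rewrite /Phi /c.
have := @weighted_window_sum R (fun k => N (t - k)%N) B; rewrite subn0.
under [X in _ -> _ -> _ + _ * X <= _]eq_bigr do rewrite subSS.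
set s1 := \sum_(k < B) _; set s2 := \sum_(k < B) _; set s3 := \sum_(k < B) _.
have F0 : 0 <= F := frobenius_norm_ge0 X.
move=> h; have -> : s1 = s2 + B%:R * N t - s3 by lra.
move: (energy _ _) (energy _ _) => *; lra.
Qed.

Let E0 : R := - (2^-1 * dot q0 (X *m q0)).

Lemma window_ge0 t : 0 <= F * \sum_(k < B) (B - k)%:R * N (t - k.+1).
Proof.
rewrite mulr_ge0 ?frobenius_norm_ge0// sumr_ge0// => k _.
by rewrite mulr_ge0 ?N_ge0.
Qed.

Lemma lyapunov_ge t : E0 <= Phi t.
Proof.
have := energy_lower (b t) (a_ge0 t); have := window_ge0 t.
have := X_ge0 (b t - a t - q0); rewrite /Phi /E0; lra.
Qed.

Lemma N_cvg0 : N t @[t --> \oo] --> (0 : R).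
Proof.
apply: (@nonincreasing_summand_cvg0 _ Phi _ c E0 B).
- by rewrite /c subr_gt0.
- exact: N_ge0.
- by move=> t _; exact: lyapunov_ge.
- exact: lyapunov_descent.
Qed.

Lemma lyapunov_le t : (B <= t)%N -> Phi t <= Phi B.
Proof.
move=> /subnKC <-; elim: (t - B)%N => [|k IH]; first by rewrite addn0.
rewrite addnS; apply: le_trans (lyapunov_descent _) _; first exact: leq_addr.
apply: le_trans IH; rewrite gerBl mulr_ge0 ?N_ge0//.
by rewrite /c subr_ge0 ltW.
Qed.

Lemma increments_small e : 0 < e -> exists t0, forall t, (t0 <= t)%N -> forall i,
  `|a t.+1 i 0 - a t i 0| <= e /\ `|b t.+1 i 0 - b t i 0| <= e.
Proof.
move=> e0; have /cvgn_distP/(_ (e ^+ 2)) [|t0 ht] := N_cvg0.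
  by rewrite exprn_gt0.
exists t0 => t /ht; rewrite subr0 ger0_norm ?N_ge0// => Nt i.
have le_dot (u : 'cV[R]_n) : u i 0 ^+ 2 <= dot u u.
  by rewrite /dot (bigD1 i)//= -expr2 lerDl sumr_ge0// => j _; rewrite -expr2 sqr_ge0.
have := le_dot (a t.+1 - a t); have := le_dot (b t.+1 - b t).
have := dot_ge0 (a t.+1 - a t); have := dot_ge0 (b t.+1 - b t).
move: Nt; rewrite /N !subvE.
move: (dot _ _) (dot _ _) => x y h hx hy h1 h2.
split; rewrite -ler_sqr ?nnegrE ?(ltW e0)// real_normK ?num_real//; lra.
Qed.

Lemma distance_small e t0 (u : nat -> R) :
  (forall t, (t0 <= t)%N -> `|u t.+1 - u t| <= e) ->
  forall s t, (t0 <= s <= t)%N -> `|u t - u s| <= e * (t - s)%:R.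
Proof.
move=> h s t /andP[s0 /subnKC <-]; elim: (t - s)%N => [|k IH].
  by rewrite addn0 subrr normr0 subnn mulr0.
rewrite addnS -(subrKA (u (s + k)%N)); apply: le_trans (ler_normD _ _) _.
rewrite subSn ?leq_addr// -natr1 mulrDr mulr1 addrC lerD//.
by apply: h; rewrite (leq_trans s0)// leq_addr.
Qed.

(** * Boundedness of voltages and multipliers *)

Lemma m_bounded : exists2 M, 0 <= M & forall t, (B <= t)%N -> forall i,
  `|m t i 0| <= M /\ `|V t i 0 - vlo i 0| <= M.
Proof.
have Xu := pd_unitmx X_eq0.
(* [Phi] never exceeds [Phi B], so [C] bounds the form at [m t - q0]; as [X *m (m t - q0)] is
   [V t - vlo], this bounds the voltages, and inverting [X] bounds [m]. *)
pose C := 2 * (Phi B - E0).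
have hC t : (B <= t)%N -> dot (m t - q0) (X *m (m t - q0)) <= C.
  move=> /lyapunov_le; rewrite /C.
  have := energy_lower (b t) (a_ge0 t); have := window_ge0 t.
  rewrite -/(m t) {1}/Phi /E0; lra.
have XV t : X *m (m t - q0) = V t - vlo.
  by rewrite mulmxBr /q0 mulKVmx// /V opprB addrA.
pose M1 := \sum_i Num.sqrt (X i i * C).
have hV t i : (B <= t)%N -> `|V t i 0 - vlo i 0| <= M1.
  move=> Bt; apply: le_trans (_ : Num.sqrt (X i i * C) <= _).
    have C0 : 0 <= C by apply: le_trans (hC _ Bt).
    have Xi : 0 <= X i i by rewrite -dot_delta_mulmx.
    have XC : 0 <= X i i * C by exact: mulr_ge0.
    rewrite -sqrtr_sqr ler_sqrt//.
    have := psd_entry_sqr_le X_sym X_ge0 (m t - q0) i.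
    rewrite XV subvE => h; apply: le_trans h _.
    by rewrite -XV ler_wpM2l// hC.
  by rewrite /M1 (bigD1 i)//= lerDl sumr_ge0// => j _; exact: sqrtr_ge0.
have M10 : 0 <= M1 by apply: sumr_ge0 => i _; exact: sqrtr_ge0.
pose M2 := \sum_i (`|q0 i 0| + \sum_j `|invmx X i j| * M1).
have M2i i : 0 <= `|q0 i 0| + \sum_j `|invmx X i j| * M1.
  by rewrite addr_ge0// sumr_ge0// => j _; rewrite mulr_ge0.
have M20 : 0 <= M2 by apply: sumr_ge0.
exists (M1 + M2); first by rewrite addr_ge0.
move=> t Bt i; split; last by apply: le_trans (hV _ _ Bt) _; rewrite lerDl.
have -> : m t = q0 + invmx X *m (V t - vlo) by rewrite -XV mulKmx// subrKC.
apply: le_trans (_ : `|q0 i 0| + \sum_j `|invmx X i j| * M1 <= _); last first.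
  by rewrite [M2](bigD1 i)//= addrCA lerDl addr_ge0// sumr_ge0.
rewrite addvE; apply: le_trans (ler_normD _ _) _; rewrite lerD2l mxE.
apply: le_trans (ler_norm_sum _ _ _) _; apply: ler_sum => j _.
by rewrite normrM ler_wpM2l// subvE hV.
Qed.

Lemma ab_bounded : exists2 C, 0 <= C & forall t, (B <= t)%N -> forall i,
  a t i 0 <= C /\ b t i 0 <= C.
Proof.
have [M M0 hM] := m_bounded.
(* The sum of the two multipliers of a bus never exceeds the larger of its value at [B] and [M], by
   [projected_pair_sum]. *)
pose C := M + \sum_i (a B i 0 + b B i 0).
have S0 i : 0 <= a B i 0 + b B i 0 by rewrite addr_ge0 ?a_coord_ge0 ?b_coord_ge0.
have C0 : 0 <= C by rewrite addr_ge0// sumr_ge0.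
exists C => // t Bt i; suff : a t i 0 + b t i 0 <= C.
  by have := a_coord_ge0 t i; have := b_coord_ge0 t i; lra.
move: Bt => /subnKC <-; elim: (t - B)%N => [|k IH].
  by rewrite addn0 /C (bigD1 i)//= addrCA lerDl addr_ge0// sumr_ge0.
rewrite addnS; set s := (B + k)%N in IH *.
have [Ui|/idle_step[-> ->]//] := pselect (U s i).
have [hm _] := hM s.+1 (leqW (leq_addr _ _)) i.
have := @projected_pair_sum R (a s i 0) (b s i 0) (eps * (w s i 0 - vlo i 0))
  (eps * (vup i 0 - vlo i 0)) (a_coord_ge0 s i) (b_coord_ge0 s i).
rewrite mulr_ge0 ?subr_ge0 ?(ltW eps_gt0)// => /(_ isT).
have -> : eps * (w s i 0 - vlo i 0) - eps * (vup i 0 - vlo i 0) =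
  eps * (w s i 0 - vup i 0) by ring.
have -> : b s i 0 - eps * (w s i 0 - vlo i 0) =
  b s i 0 + eps * (vlo i 0 - w s i 0) by ring.
have [<- <-] := update_step Ui; rewrite -m_coordE => h; apply: le_trans h _.
rewrite ge_max IH (le_trans hm)// /C lerDl sumr_ge0//.
Qed.

(** * Vanishing KKT residuals and convergence *)

Lemma residual_small e : 0 < e -> exists t0, forall t, (t0 <= t)%N -> forall i,
  `|Num.min (a t i 0) (eps * (vup i 0 - V t i 0))| <= e /\
  `|Num.min (b t i 0) (eps * (V t i 0 - vlo i 0))| <= e.
Proof.
move=> e0.
pose A := \sum_i \sum_j `|X i j|.
have A0 : 0 <= A by do 2 (apply: sumr_ge0 => ? _).
(* With increments at most [e / D]: [1] pays for the next update step of bus [i], [K] for the drift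
   of its multiplier until then, and the last term for the gap between the voltage used there and
   [V t]. *)
pose D : R := 1 + K%:R + eps * (A * (2 * (B + K)%:R)).
have D0 : 0 < D.
  have k0 : 0 <= K%:R :> R by [].
  have : 0 <= eps * (A * (2 * (B + K)%:R)) by rewrite !mulr_ge0// ltW.
  rewrite /D; lra.
have [t0 ht0] := increments_small (divr_gt0 e0 D0).
set r := e / D in ht0; have r0 : 0 <= r by rewrite divr_ge0// ltW.
have eD : e = r * D by rewrite mulfVK ?gt_eqF.
have da i := @distance_small r t0 (fun t => a t i 0) (fun t h => (ht0 t h i).1).
have db i := @distance_small r t0 (fun t => b t i 0) (fun t h => (ht0 t h i).2).
have dm s s' j : (t0 <= s <= s')%N -> `|m s' j 0 - m s j 0| <= r * (2 * (s' - s)%:R).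
  move=> h; have := da j _ _ h; have := db j _ _ h; rewrite !m_coordE.
  set x := b s' j 0 - b s j 0; set y := a s' j 0 - a s j 0 => hx hy.
  have -> : b s' j 0 - a s' j 0 - (b s j 0 - a s j 0) = x - y by rewrite /x /y; ring.
  by apply: le_trans (ler_normB _ _) _; lra.
exists (t0 + B)%N => t ht i.
have [k kK Ui] := frequent t i; set s := (t + k)%N in Ui.
have ts : (t0 <= t <= s)%N by rewrite leq_addr (leq_trans (leq_addr B t0)).
have Bs : (B <= s)%N by rewrite (leq_trans _ (leq_addr _ _))// (leq_trans (leq_addl t0 B)).
have [rr hr wE] := stale Bs Ui.
have wV : `|w s i 0 - V t i 0| <= r * (A * (2 * (B + K)%:R)).
  rewrite wE V_coordE opprD addrACA subrr addr0 -sumrB.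
  apply: le_trans (ler_norm_sum _ _ _) _.
  apply: le_trans (_ : \sum_j `|X i j| * (r * (2 * (B + K)%:R)) <= _).
    apply: ler_sum => j _; rewrite -mulrBr normrM ler_wpM2l//.
    have /andP[h1 h2] := hr j.
    have [tr|rt] := leqP t (rr j).
      apply: le_trans (dm _ _ _ _) _.
        by rewrite tr andbT; case/andP: ts.
      by rewrite ler_wpM2l// ler_wpM2l// ler_nat; move: h2 kK; rewrite /s; clear; lia.
    rewrite distrC; apply: le_trans (dm _ _ _ _) _.
      by rewrite (ltnW rt) andbT; move: h1 ht; rewrite /s; clear; lia.
    by rewrite ler_wpM2l// ler_wpM2l// ler_nat; move: h1 kK; rewrite /s; clear; lia.
  rewrite -mulr_suml mulrCA ler_wpM2l// ler_wpM2r ?mulr_ge0//.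
  rewrite [A](bigD1 i)//= lerDl; apply: sumr_ge0 => i' _; exact: sumr_ge0.
have kr : r * (s - t)%:R <= r * K%:R.
  by rewrite ler_wpM2l// ler_nat /s addKn ltnW.
have s0 : (t0 <= s)%N by case/andP: ts => /leq_trans h /h.
have [ea eb] := update_step Ui; have [sa sb] := ht0 s s0 i.
have hav := da i _ _ ts; have hbv := db i _ _ ts.
have ewV : eps * `|w s i 0 - V t i 0| <= r * (eps * (A * (2 * (B + K)%:R))).
  by rewrite (mulrCA r) ler_wpM2l// ltW.
rewrite eD /D !(mulrDr r) mulr1; split.
- have := min_dist (a t i 0) (eps * (vup i 0 - V t i 0)) (a s i 0)
     (- (eps * (w s i 0 - vup i 0))).
  rewrite projected_step_residual -ea distrC in sa *.
  rewrite (distrC (a t i 0)).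
  have -> : eps * (vup i 0 - V t i 0) - - (eps * (w s i 0 - vup i 0)) =
     eps * (w s i 0 - V t i 0) by ring.
  rewrite normrM (gtr0_norm eps_gt0) => h.
  have := ler_normD (a s i 0 - a s.+1 i 0)
    (Num.min (a t i 0) (eps * (vup i 0 - V t i 0)) - (a s i 0 - a s.+1 i 0)).
  rewrite subrKC; lra.
- have := min_dist (b t i 0) (eps * (V t i 0 - vlo i 0)) (b s i 0)
     (- (eps * (vlo i 0 - w s i 0))).
  rewrite projected_step_residual -eb distrC in sb *.
  rewrite (distrC (b t i 0)).
  have -> : eps * (V t i 0 - vlo i 0) - - (eps * (vlo i 0 - w s i 0)) =
     eps * (- (w s i 0 - V t i 0)) by ring.
  rewrite normrM normrN (gtr0_norm eps_gt0) => h.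
  have := ler_normD (b s i 0 - b s.+1 i 0)
    (Num.min (b t i 0) (eps * (V t i 0 - vlo i 0)) - (b s i 0 - b s.+1 i 0)).
  rewrite subrKC; lra.
Qed.

Lemma residual_cvg0 i :
  (Num.min (a t i 0) (eps * (vup i 0 - V t i 0)) @[t --> \oo] --> (0 : R)) /\
  (Num.min (b t i 0) (eps * (V t i 0 - vlo i 0)) @[t --> \oo] --> (0 : R)).
Proof.
split; apply/cvgn_distP => e /residual_small[t0 ht]; exists t0 => t /ht/(_ i)[];
  by rewrite subr0.
Qed.


(* For two late times s and t the residual bounds give                         *)
(* (m t - m s)^T X (m t - m s) = O(r), by monotonicity of the KKT conditions.  *)
Lemma V_cvg i : exists l : R, V t i 0 @[t --> \oo] --> l.
Proof.
have [M M0 hM] := m_bounded; have [C C0 hC] := ab_bounded.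
pose D := M + \sum_j (vup j 0 - vlo j 0).
have hD j : M + (vup j 0 - vlo j 0) <= D.
  by rewrite lerD2l (bigD1 j)//= lerDl sumr_ge0// => k _; rewrite subr_ge0 v_le.
have D0 : 0 <= D by rewrite addr_ge0// sumr_ge0// => k _; rewrite subr_ge0 v_le.
pose L := C / eps + D + C / eps.
have Ce : 0 <= C / eps by rewrite divr_ge0// ltW.
have L0 : 0 <= L by exact: addr_ge0 (addr_ge0 Ce D0) Ce.
have Xi : 0 <= X i i by rewrite -dot_delta_mulmx.
(* [psd_entry_sqr_le] contributes [X i i], and each of the [n] buses contributes four cross terms of
   size at most [r * L]. *)
pose Z := X i i * (n%:R * (4 * L)).
have Z0 : 0 <= Z by rewrite !mulr_ge0.
apply: cauchy_distP => e e0.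
pose r := e ^+ 2 / (Z + 1).
have r0 : 0 < r by rewrite divr_gt0 ?exprn_gt0// ltr_wpDl.
have rZ : r * Z <= e ^+ 2.
  rewrite /r mulrAC -mulrA ler_piMr ?sqr_ge0// ler_pdivrMr ?ltr_wpDl//.
  by rewrite mul1r lerDl.
have [t0 ht] := residual_small r0; exists (maxn t0 B) => s t.
rewrite !geq_max => /andP[ts Bs] /andP[tt Bt].
have bound t' j : (B <= t')%N -> (V t' j 0 - vlo j 0 <= D) /\ (vup j 0 - V t' j 0 <= D).
  move=> Bt'; have := (hM t' Bt' j).2; rewrite ler_norml => /andP[h1 h2].
  have := hD j; have := v_le j; move: (V t' j 0) h1 h2 => *; split; lra.
(* Each voltage difference is a difference of slacks: the one at [t'] is nearly complementary to the
   multiplier, the one at [s'] nearly nonnegative. *)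
have half s' t' j : (t0 <= s')%N -> (t0 <= t')%N -> (B <= s')%N -> (B <= t')%N ->
    b t' j 0 * (V t' j 0 - V s' j 0) <= r * L /\
    a t' j 0 * (V s' j 0 - V t' j 0) <= r * L.
  move=> hs ht' Bs' Bt'; have [D1 D2] := bound t' j Bt'; have [D3 D4] := bound s' j Bs'.
  have [C1 C2] := hC t' Bt' j.
  have [ra rb] := ht t' ht' j; have [ra' rb'] := ht s' hs j.
  have xa : 0 <= a t' j 0 <= C by rewrite a_coord_ge0.
  have xb : 0 <= b t' j 0 <= C by rewrite b_coord_ge0.
  have xa' : 0 <= a s' j 0 <= C by rewrite a_coord_ge0 (hC s' Bs' j).1.
  have xb' : 0 <= b s' j 0 <= C by rewrite b_coord_ge0 (hC s' Bs' j).2.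
  have [_ ya] := approx_complementarity eps_gt0 xa' D4 D0 ra'.
  have [_ yb] := approx_complementarity eps_gt0 xb' D3 D0 rb'.
  split.
    have := approx_monotone eps_gt0 xb D1 D0 rb yb.
    by rewrite opprB addrA subrK.
  have := approx_monotone eps_gt0 xa D2 D0 ra ya.
  have -> // : vup j 0 - V t' j 0 - (vup j 0 - V s' j 0) = V s' j 0 - V t' j 0.
  by move: (V _ _ _) (V _ _ _) => *; ring.
have XV : X *m (m t - m s) = V t - V s.
  by rewrite mulmxBr /V opprD addrACA subrr addr0.
have Q : dot (m t - m s) (X *m (m t - m s)) <= n%:R * (4 * (r * L)).
  rewrite XV; have -> : n%:R * (4 * (r * L)) = \sum_(j < n) 4 * (r * L).
    by rewrite sumr_const card_ord mulr_natl.
  apply: ler_sum => j _; rewrite !subvE ?m_coordE.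
  have [h1 h2] := half s t j ts tt Bs Bt; have [h3 h4] := half t s j tt ts Bt Bs.
  move: (V t j 0) (V s j 0) h1 h2 h3 h4 => *; lra.
rewrite -ler_sqr ?nnegrE ?(ltW e0)// real_normK ?num_real//.
have := psd_entry_sqr_le X_sym X_ge0 (m t - m s) i.
rewrite {1}XV subvE => h; apply: le_trans h _; apply: le_trans rZ.
have -> : r * Z = X i i * (n%:R * (4 * (r * L))) by rewrite /Z; ring.
by rewrite ler_wpM2l.
Qed.

Lemma equal_bounds_sum_cvg i : vlo i 0 = vup i 0 ->
  exists l : R, a t i 0 + b t i 0 @[t --> \oo] --> l.
Proof.
move=> lo_up; have [C C0 hC] := ab_bounded.
have inc : nondecreasing_seq (fun t => a t i 0 + b t i 0).
  apply/nondecreasing_seqP => t.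
  have [Ui|/idle_step[-> ->]//] := pselect (U t i).
  have [-> ->] := update_step Ui.
  have -> : eps * (vlo i 0 - w t i 0) = - (eps * (w t i 0 - vup i 0)).
    by rewrite lo_up; ring.
  exact: projected_pair_sum_ge.
exists (limn (fun t => a t i 0 + b t i 0)); apply: nondecreasing_is_cvgn => //.
exists (C + C) => _ [t _ <-]; apply: le_trans (inc _ _ (leq_addr B t)) _.
by have [h1 h2] := hC (t + B)%N (leq_addl _ _) i; rewrite lerD.
Qed.

Theorem async_ascent_cvg : exists as_ bs : 'cV[R]_n,
  [/\ kkt X vpar vlo vup as_ bs,
      forall i, a t i 0 @[t --> \oo] --> as_ i 0 &
      forall i, b t i 0 @[t --> \oo] --> bs i 0].
Proof.
have Xu := pd_unitmx X_eq0.
have [vs hvs] := choice V_cvg; pose vS : 'cV[R]_n := \col_i vs i.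
have vc i : V t i 0 @[t --> \oo] --> vS i 0 by rewrite mxE.
pose mS := invmx X *m (vS - vpar).
have mc i : m t i 0 @[t --> \oo] --> mS i 0.
  have -> : (fun t => m t i 0) = (fun t => (invmx X *m (V t - vpar)) i 0).
    by apply/funext => t; rewrite /V addrK mulKmx.
  apply: cvgn_mulmx => j; rewrite subvE; under eq_fun do rewrite subvE.
  by apply: cvgB => //; exact: cvg_cst.
have upc i : eps * (vup i 0 - V t i 0) @[t --> \oo] --> eps * (vup i 0 - vS i 0).
  by apply: cvgMr; apply: cvgB => //; exact: cvg_cst.
have loc i : eps * (V t i 0 - vlo i 0) @[t --> \oo] --> eps * (vS i 0 - vlo i 0).
  by apply: cvgMr; apply: cvgB => //; exact: cvg_cst.
have ab i : exists p : R * R, (a t i 0 @[t --> \oo] --> p.1) /\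
    (b t i 0 @[t --> \oo] --> p.2) .
  have [ra rb] := residual_cvg0 i.
  have bE : (fun t => b t i 0) = (fun t => m t i 0 + a t i 0).
    by apply/funext => t; rewrite m_coordE subrK.
  have aE : (fun t => a t i 0) = (fun t => b t i 0 - m t i 0).
    by apply/funext => t; rewrite m_coordE opprB addrC subrK.
  (* A limit that is slack at [vS] sends its multiplier to zero, and [m] gives the other. If neither
     is slack, the limits coincide and the sum of the multipliers converges as well as their
     difference. *)
  have [vlt|vge] := ltP (vS i 0) (vup i 0).
    have ac : a t i 0 @[t --> \oo] --> (0 : R).
      by apply: min_cvg0_left ra (upc i); rewrite mulr_gt0// subr_gt0.
    by exists (0, mS i 0 + 0); split => //=; rewrite bE; apply: cvgD.
  have [vlt|vle] := ltP (vlo i 0) (vS i 0).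
    have bc : b t i 0 @[t --> \oo] --> (0 : R).
      by apply: min_cvg0_left rb (loc i); rewrite mulr_gt0// subr_gt0.
    by exists (0 - mS i 0, 0); split => //=; rewrite aE; apply: cvgB.
  have lo_up : vlo i 0 = vup i 0.
    by apply/eqP; rewrite eq_le v_le /= (le_trans vge vle).
  have [l hl] := equal_bounds_sum_cvg lo_up.
  exists (2^-1 * (l - mS i 0), 2^-1 * (l + mS i 0)); split => /=.
    have -> : (fun t => a t i 0) = (fun t => 2^-1 * (a t i 0 + b t i 0 - m t i 0)).
      by apply/funext => t; rewrite m_coordE; field.
    by apply: cvgMr; apply: cvgB.
  have -> : (fun t => b t i 0) = (fun t => 2^-1 * (a t i 0 + b t i 0 + m t i 0)).
    by apply/funext => t; rewrite m_coordE; field.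
  by apply: cvgMr; apply: cvgD.
have [p hp] := choice ab.
pose as_ : 'cV[R]_n := \col_i (p i).1; pose bs : 'cV[R]_n := \col_i (p i).2.
have ac i : a t i 0 @[t --> \oo] --> as_ i 0 by rewrite mxE; exact: (hp i).1.
have bc i : b t i 0 @[t --> \oo] --> bs i 0 by rewrite mxE; exact: (hp i).2.
have mSE : bs - as_ = mS.
  apply/colP => i; rewrite subvE; apply: (cvgn_unique _ (mc i)).
  have -> : (fun t => m t i 0) = (fun t => b t i 0 - a t i 0).
    by apply/funext => t; rewrite m_coordE.
  exact: cvgB.
have VS : X *m (bs - as_) + vpar = vS by rewrite mSE mulKVmx// subrK.
have resa i : Num.min (as_ i 0) (eps * (vup i 0 - vS i 0)) = 0.
  by apply: (cvgn_unique _ (residual_cvg0 i).1); exact: cvgn_min.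
have resb i : Num.min (bs i 0) (eps * (vS i 0 - vlo i 0)) = 0.
  by apply: (cvgn_unique _ (residual_cvg0 i).2); exact: cvgn_min.
exists as_, bs; split=> //; split.
- by move=> i; have [h _ _] := min_eq0_complementary (resa i); rewrite [X in X <= _]mxE.
- by move=> i; have [h _ _] := min_eq0_complementary (resb i); rewrite [X in X <= _]mxE.
- rewrite /primal_feasible VS; split=> i.
    have [_ h _] := min_eq0_complementary (resa i).
    by move: h; rewrite pmulr_rge0// subr_ge0.
  have [_ h _] := min_eq0_complementary (resb i).
  by move: h; rewrite pmulr_rge0// subr_ge0.
- move=> i; rewrite VS.
  have [_ _ h1] := min_eq0_complementary (resa i).
  have [_ _ h2] := min_eq0_complementary (resb i).
  move: h1 h2; rewrite !(mulrCA _ eps) => /eqP h1 /eqP h2.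
  by move: h1 h2; rewrite !mulf_eq0 !(gt_eqF eps_gt0) /= -!mulf_eq0 => /eqP ? /eqP.
Qed.

End AsynchronousAscent.

(** * Algorithm 2 *)

Section UpdateTimes.
Variables (T : set nat) (Ta : nat).
Hypothesis T_inf : infinite_set T.
Hypothesis T_gap : gaps_bounded T Ta.

Lemma infinite_set_unbounded N : exists2 t, (N <= t)%N & T t.
Proof.
apply: contrapT => h; apply: T_inf; apply: (sub_finite_set (B := `I_N)) => // t Tt.
by rewrite /= ltnNge; apply/negP => Nt; apply: h; exists t.
Qed.

(** The last update up to [s] and the first one after [s] are consecutive, hence at most [Ta]
    apart. *)
Lemma last_update t1 s : T t1 -> (t1 <= s)%N -> exists s',
  [/\ (t1 <= s' <= s)%N, (s < s' + Ta)%N, T s' &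
      forall t, (s' < t <= s)%N -> ~ T t].
Proof.
move=> T1 t1s.
pose P t := (t <= s)%N && `[< T t >].
have exP : exists t, P t by exists t1; rewrite /P t1s; apply/asboolP.
have ubP t : P t -> (t <= s)%N by case/andP.
have [s' /andP[s's /asboolP Ts'] maxs'] := ex_maxnP exP ubP.
pose Q t := (s < t)%N && `[< T t >].
have exQ : exists t, Q t.
  have [t st Tt] := infinite_set_unbounded s.+1.
  by exists t; rewrite /Q st; apply/asboolP.
have [u /andP[su /asboolP Tu] minu] := ex_minnP exQ.
have none t : (s' < t <= s)%N -> ~ T t.
  move=> /andP[s't ts] Tt; have : P t by rewrite /P ts; apply/asboolP.
  by move=> /maxs'; rewrite leqNgt s't.
exists s'; split => //.
  rewrite s's andbT; apply: maxs'; rewrite /P t1s; exact/asboolP.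
have : (u - s' <= Ta)%N.
  apply: T_gap => //; first exact: leq_ltn_trans s's su.
  move=> t /andP[s't tu]; have [ts|st] := leqP t s; first by apply: none; rewrite s't.
  move=> Tt; have : Q t by rewrite /Q st; apply/asboolP.
  by move=> /minu; rewrite leqNgt tu.
by rewrite leq_subLR; apply: leq_trans.
Qed.

End UpdateTimes.

Section Algorithm.
Variables (R : realType) (n : nat) (X : 'M[R]_n) (vpar vlo vup : 'cV[R]_n).
Variables (eps : R) (T : 'I_n -> set nat) (tau tau' : 'I_n -> nat -> nat).
Variables (lup llo q v : int -> 'cV[R]_n) (Ta Td : nat).
Hypothesis T_pos : forall i t, T i t -> (0 < t)%N.
Hypothesis T_inf : forall i, infinite_set (T i).
Hypothesis alg : algorithm2 X vpar vlo vup eps T tau tau' lup llo q v.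
Hypothesis T_gap : forall i, gaps_bounded (T i) Ta.
Hypothesis delay_le : forall i t, (tau i t <= Td)%N /\ (tau' i t <= Td)%N.

Lemma predz t : t.+1%:Z - 1 = t%:Z.
Proof. by rewrite intS addrAC subrr add0r. Qed.

Lemma q_idle j s' s : (s' <= s)%N -> (forall t, (s' < t <= s)%N -> ~ T j t) ->
  q s%:Z j 0 = q s'%:Z j 0.
Proof.
move=> /subnKC <-; elim: (s - s')%N => [|k IH] none; first by rewrite addn0.
have nT : ~ T j (s' + k).+1 by apply: none; rewrite addnS ltnS leq_addr leqnn.
rewrite addnS; have [_ _ ->] := idle alg (ltn0Sn _) nT.
rewrite predz; apply: IH => t /andP[h1 h2]; apply: none.
by rewrite h1 addnS leqW.
Qed.

(** An injection is held since the last update of its bus. Starting from an update at time [Td] or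
    later keeps the delayed time nonnegative. *)
Lemma eventually_stale_q : exists t0, forall s, (t0 <= s)%N -> forall j,
  exists2 r, (r <= s < r + (Ta + Td))%N &
    q s%:Z j 0 = llo r%:Z j 0 - lup r%:Z j 0.
Proof.
apply: finite_eventually => j.
have [t1 Td1 T1] := infinite_set_unbounded (@T_inf j) Td.
exists t1 => s t1s.
have [s' [/andP[h1 h2] h3 Ts' none]] := last_update (@T_inf j) (@T_gap j) T1 t1s.
have [_ _ qE] := update alg (T_pos Ts') Ts'.
have [_ dl] := delay_le j s'.
exists (s' - tau' j s')%N.
  rewrite (leq_trans (leq_subr _ _) h2) /=; apply: leq_trans h3 _.
  by move: (tau' j s') dl; clear; lia.
by rewrite (q_idle h2 none) qE subzn// (leq_trans dl)// (leq_trans Td1).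
Qed.

(** Initial multipliers may be negative; the first update of a bus projects them. *)
Lemma eventually_multipliers_ge0 : exists t0, forall t, (t0 <= t)%N -> forall i,
  0 <= lup t%:Z i 0 /\ 0 <= llo t%:Z i 0.
Proof.
apply: finite_eventually => i.
have [t1 _ T1] := infinite_set_unbounded (@T_inf i) 0.
exists t1 => t /subnKC <-; elim: (t - t1)%N => [|k IH].
  rewrite addn0; have [-> -> _] := update alg (T_pos T1) T1.
  by rewrite !le_max lexx.
rewrite addnS; have [Tt|nTt] := pselect (T i (t1 + k).+1).
  have [-> -> _] := update alg (ltn0Sn _) Tt.
  by rewrite !le_max lexx.
by have [-> -> _] := idle alg (ltn0Sn _) nTt; rewrite predz.
Qed.

Hypothesis n_gt0 : (0 < n)%N.
Hypothesis X_sym : X^T = X.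
Hypothesis X_ge0 : forall w : 'cV[R]_n, 0 <= dot w (X *m w).
Hypothesis X_eq0 : forall w : 'cV[R]_n, dot w (X *m w) = 0 -> w = 0.
Hypothesis v_le : le_vec vlo vup.
Hypothesis eps_gt0 : 0 < eps.
Hypothesis step_small :
  sigma_max X + 2 * frobenius_norm X * (2 * Td + Ta)%:R < eps^-1.

Lemma multipliers_cvg : exists as_ bs : 'cV[R]_n,
  [/\ kkt X vpar vlo vup as_ bs,
      forall i, lup t%:Z i 0 @[t --> \oo] --> as_ i 0 &
      forall i, llo t%:Z i 0 @[t --> \oo] --> bs i 0].
Proof.
have [t0 stale_q] := eventually_stale_q.
have [t0' ge0] := eventually_multipliers_ge0.
have [t2 T2] : exists t2, forall t, (t2 <= t)%N -> forall i,
    exists2 s, (s <= t)%N & T i s.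
  apply: finite_eventually => i.
  by have [s _ Ts] := infinite_set_unbounded (@T_inf i) 0; exists s => t; exists s.
(* New time origin: every bus has acted, the multipliers are nonnegative, and a reading [Td] steps
   late still falls after [t0]. *)
pose t1 := (maxn t0 (maxn t0' t2) + Td)%N.
have t01 : (t0 + Td <= t1)%N by rewrite leq_add2r leq_maxl.
have t01' : (t0' <= t1)%N.
  by rewrite (leq_trans _ (leq_addr _ _))// leq_max leq_max leqnn orbT.
have t21 : (t2 <= t1)%N.
  by rewrite (leq_trans _ (leq_addr _ _))// leq_max leq_max leqnn !orbT.
pose a t := lup (t1 + t)%N%:Z; pose b t := llo (t1 + t)%N%:Z.
(* Step [t] leads from time [t1 + t] to the next one, hence the successor. *)
pose U t i := T i (t1 + t).+1.
pose w t : 'cV[R]_n :=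
  \col_i v ((t1 + t).+1%:Z - (tau i (t1 + t).+1)%:Z) i 0.
have [||||||as_ [bs [k ac bc]]] := @async_ascent_cvg R n X vpar vlo vup n_gt0
  X_sym X_ge0 X_eq0 v_le eps (2 * Td + Ta) Ta eps_gt0 step_small a b w U.
- move=> t i; rewrite [X in X <= _]mxE.
  by have [] := ge0 (t1 + t)%N (leq_trans t01' (leq_addr _ _)) i.
- move=> t i; rewrite [X in X <= _]mxE.
  by have [] := ge0 (t1 + t)%N (leq_trans t01' (leq_addr _ _)) i.
- move=> t i nT; rewrite /a /b addnS.
  by have [-> -> _] := idle alg (ltn0Sn _) nT; rewrite predz.
- move=> t i Tt; rewrite /a /b addnS mxE.
  by have [-> -> _] := update alg (ltn0Sn _) Tt; rewrite predz.
(* The voltage read has time [s + 1] and is produced by the injections at time [s], which lag by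
   less than [Ta + Td]. *)
- move=> t i Bt Tt; set s := (t1 + t - tau i (t1 + t).+1)%N.
  have [dl _] := delay_le i (t1 + t).+1.
  have sE : (t1 + t).+1%:Z - (tau i (t1 + t).+1)%:Z = s%:Z + 1.
    rewrite subzn; last by move: dl t01; clear; lia.
    by rewrite addrC -intS; congr (_%:Z); rewrite /s; move: dl t01; clear; lia.
  have s0 : (t0 <= s)%N by rewrite /s; move: dl t01; clear; lia.
  have /choice[r hr] : forall j, exists r, (r <= s < r + (Ta + Td))%N /\
      q s%:Z j 0 = llo r%:Z j 0 - lup r%:Z j 0.
    by move=> j; have [r h1 h2] := stale_q s s0 j; exists r.
  have t1r j : (t1 <= r j)%N.
    have [/andP[_]] := hr j; rewrite /s; move: (r j) dl Bt; clear; lia.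
  exists (fun j => r j - t1)%N.
    move=> j; have [/andP[]] := hr j; rewrite /s.
    by move: (r j) (t1r j) dl Bt; clear; lia.
  rewrite mxE sE (voltage alg) !mxE; congr (_ + _); apply: eq_bigr => j _.
  by rewrite /a /b !mxE subnKC// (hr j).2.
- move=> t i; have [s st Ts] := T2 _ (leq_trans t21 (leq_addr t t1)) i.
  (* The last update up to time [t1 + t + Ta] comes after [t1 + t]. *)
  have [u [/andP[su ut] tu Tu _]] :=
    last_update (@T_inf i) (@T_gap i) Ts (leq_trans st (leq_addr Ta (t1 + t))).
  exists (u - (t1 + t).+1)%N; first by move: tu ut; clear; lia.
  by rewrite /U (_ : (t1 + _).+1 = u)//; move: tu; clear; lia.
exists as_, bs; split=> // i.
  rewrite -(cvg_shiftn t1) /=.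
  have -> // : (fun t => lup (t + t1)%N%:Z i 0) = (fun t => a t i 0).
  by apply/funext => t; rewrite /a addnC.
rewrite -(cvg_shiftn t1) /=.
have -> // : (fun t => llo (t + t1)%N%:Z i 0) = (fun t => b t i 0).
by apply/funext => t; rewrite /b addnC.
Qed.

Lemma injections_cvg (as_ bs : 'cV[R]_n) :
  (forall i, lup t%:Z i 0 @[t --> \oo] --> as_ i 0) ->
  (forall i, llo t%:Z i 0 @[t --> \oo] --> bs i 0) ->
  forall i, q t%:Z i 0 @[t --> \oo] --> (bs - as_) i 0.
Proof.
move=> ac bc i; have /cvgn_distP mc :
    llo t%:Z i 0 - lup t%:Z i 0 @[t --> \oo] --> bs i 0 - as_ i 0 by apply: cvgB.
have [t0 stale_q] := eventually_stale_q.
rewrite subvE; apply/cvgn_distP => e /mc[t1 ht].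
exists (t0 + t1 + (Ta + Td))%N => t tge.
have [|r hr ->] := stale_q t _ i; first by move: tge; clear; lia.
by apply: ht; move: hr tge; clear; lia.
Qed.

Lemma voltages_cvg (qs : 'cV[R]_n) :
  (forall i, q t%:Z i 0 @[t --> \oo] --> qs i 0) ->
  forall i, v t%:Z i 0 @[t --> \oo] --> (X *m qs + vpar) i 0.
Proof.
move=> qc i; rewrite -(cvg_shiftS (fun t => v t%:Z i 0)) addvE.
have -> : (fun t => v t.+1%:Z i 0) = (fun t => (X *m q t%:Z) i 0 + vpar i 0).
  by apply/funext => t; rewrite intS addrC (voltage alg) addvE.
by apply: cvgD; [exact: cvgn_mulmx | exact: cvg_cst].
Qed.

End Algorithm.

Unset Implicit Arguments.

Theorem theorem7 (R : realType) (n : nat) (hn : (0 < n)%N)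
  (E : {set line n}) (hE : is_tree E)
  (x : line n -> R) (hx : forall l : line n, l \in E -> 0 < x l)
  (X : 'M[R]_n) (hX : X = reactance_matrix E x)
  (vpar vlo vup : 'cV[R]_n) (hv : le_vec vlo vup)
  (eps : R) (heps : 0 < eps)
  (T : 'I_n -> set nat)
  (hTpos : forall i t, T i t -> (0 < t)%N)
  (hTinf : forall i, infinite_set (T i))
  (tau tau' : 'I_n -> nat -> nat)
  (lup llo q v : int -> 'cV[R]_n)
  (halg : algorithm2 X vpar vlo vup eps T tau tau' lup llo q v)
  (Ta Td : nat)
  (hTa : forall i, gaps_bounded (T i) Ta)
  (hTd : forall i t, (tau i t <= Td)%N /\ (tau' i t <= Td)%N)
  (hstep : eps < 1 / (sigma_max X + 2 * frobenius_norm X * (2 * Td%:R + Ta%:R))) :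
  exists qs lups llos vs : 'cV[R]_n,
    [/\ (primal_optimizer X vpar vlo vup qs /\
         forall q', primal_optimizer X vpar vlo vup q' -> q' = qs),
        (dual_optimizer X vpar vlo vup lups llos /\
         ((forall i, vlo i 0 < vup i 0) ->
          forall lup' llo', dual_optimizer X vpar vlo vup lup' llo' ->
            lup' = lups /\ llo' = llos)),
        q t%:Z @[t --> \oo] --> qs,
        col_mx (lup t%:Z) (llo t%:Z) @[t --> \oo] --> col_mx lups llos
      & (v t%:Z @[t --> \oo] --> vs /\ le_vec vlo vs /\ le_vec vs vup)].
Proof.
have Xs : X^T = X by rewrite hX reactance_matrix_sym.
have X0 (w : 'cV[R]_n) : 0 <= dot w (X *m w).
  by rewrite hX; exact: reactance_quad_ge0.
have X1 (w : 'cV[R]_n) : dot w (X *m w) = 0 -> w = 0.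
  by rewrite hX; exact: reactance_quad_eq0.
have step : sigma_max X + 2 * frobenius_norm X * (2 * Td + Ta)%:R < eps^-1.
  move: hstep; rewrite natrD natrM div1r; set den := _ + _.
  have den0 : 0 <= den.
    apply: addr_ge0; first exact: sigma_max_ge0.
    by rewrite !mulr_ge0 ?frobenius_norm_ge0 ?addr_ge0.
  (* As [0^-1] is [0], a zero denominator would give [eps < 0]. *)
  have [->|denN0] := eqVneq den 0; first by rewrite invr0 ltNge ltW.
  have denp : 0 < den by rewrite lt_def denN0.
  by rewrite -[X in _ -> X < _]invrK ltf_pV2 ?posrE ?invr_gt0.
have [as_ [bs [k ac bc]]] := multipliers_cvg hTpos hTinf halg hTa hTd hn Xs X0 X1 hv heps step.
have qc := injections_cvg hTpos hTinf halg hTa hTd ac bc.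
have vc := voltages_cvg halg qc.
have [_ _ [vu vl] _] := k.
exists (bs - as_), as_, bs, (X *m (bs - as_) + vpar); split.
- exact: kkt_primal_optimizer.
- exact: kkt_dual_optimizer.
- by apply: cvgn_matrix => i j; rewrite ord1.
- apply: cvgn_matrix => i j; rewrite ord1.
  case: (splitP i) => i' ii.
    have -> : i = lshift n i' by apply: val_inj.
    rewrite col_mxEu; have -> : (fun t : nat => col_mx (lup t%:Z) (llo t%:Z) (lshift n i') 0) =
      (fun t : nat => lup t%:Z i' 0); last exact: ac.
    by apply/funext => t; rewrite col_mxEu.
  have -> : i = rshift n i' by apply: val_inj.
  rewrite col_mxEd; have -> : (fun t : nat => col_mx (lup t%:Z) (llo t%:Z) (rshift n i') 0) =
    (fun t : nat => llo t%:Z i' 0); last exact: bc.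
  by apply/funext => t; rewrite col_mxEd.
- by split=> //; apply: cvgn_matrix => i j; rewrite ord1.
Qed.
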